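(* Let $F(\mathbf z)=\sum_{\mathbf r\in\mathbb N^d}a_{\mathbf r}\mathbf z^{\mathbf r}$ be a $d$-variate power series with nonnegative coefficients, and assume its logarithmic domain of convergence $\log\mathcal D$ is strictly convex. Let $f(x)=F(x,\dots,x)$ and suppose $f$ has a unique singularity $x_0$ of minimal modulus, which is a simple pole. Let $\mathbf x=(x_0,\dots,x_0)$ and suppose $F$ is meromorphic in a neighborhood of the closed polydisk $\mathbf D(\mathbf x)$, written there as $F=G/H$ with $G,H$ analytic, relatively prime, and $H$ square-free. Let $\overline{\mathbf r}=\mathrm{dir}(\mathbf x)$ be the projective class of $\left(x_1\frac{\partial H}{\partial x_1}(\mathbf x),\dots,x_d\frac{\partial H}{\partial x_d}(\mathbf x)\right)$ and $\hat{\mathbf r}=\mathbf r/|\mathbf r|$ for a representative $\mathbf r$ of $\overline{\mathbf r}$ with nonnegative coordinates. Then the measures $\mu_k'$ satisfy a weak law of large numbers with mean vector $\hat{\mathbf r}$: for every $\varepsilon>0$, $\lim_{k\to\infty}\mu'_k\{\mathbf s:|\mathbf s/k-\hat{\mathbf r}|>\varepsilon\}=0$.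
   Context: $|\mathbf r|=\sum_j|r_j|$. $\mathcal D$ is the open domain of convergence of $F$; $\log\mathcal D=\{\mathbf y\in\mathbb R^d:(e^{y_1},\dots,e^{y_d})\in\mathcal D\}$, and strictly convex means its boundary contains no line segment. $\mathbf D(\mathbf x)=\{\mathbf z:|z_i|\le|x_i|\ \forall i\}$. For each $k$, $C'_k=\sum_{\mathbf s:|\mathbf s|=k}a_{\mathbf s}$, and $\mu'_k$ is the probability measure on $\{\mathbf s\in\mathbb N^d:|\mathbf s|=k\}$ giving mass $a_{\mathbf s}/C'_k$ to $\mathbf s$.
   Formalization: Adds the hypothesis that the vector (x_j ∂H/∂x_j(x)) is nonzero, so that dir(x) is defined; it can vanish under the stated hypotheses, e.g. F = 1/(1−(2x+y)/3) + 1/(1−(x+2y)/3) at (1,1), where no weak law holds. *)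

(* Defs.v *)
From HB Require Import structures.
From mathcomp Require Import all_boot all_order all_algebra.
From mathcomp Require Import all_classical all_reals all_analysis.
From mathcomp.real_closed Require Import complex.

Set Implicit Arguments.
Unset Strict Implicit.
Unset Printing Implicit Defensive.

Import Order.TTheory GRing.Theory Num.Theory.
Import numFieldNormedType.Exports.

Local Open Scope classical_set_scope.
Local Open Scope ring_scope.

(* The norm topology of numFieldNormedType is found on the carrier of a
   numClosedFieldType but not on the bare type R[i]; hence the cast. *)
Definition cplx (R : realType) : numClosedFieldType := R[i].

Definition ofreal (R : realType) (t : R) : cplx R := t%:C%C.

Section MultiIndices.
Variable d : nat.

Definition multiindex := {ffun 'I_d -> nat}.

Definition mdeg (s : multiindex) : nat := (\sum_j s j)%N.

Definition shell (k : nat) : set multiindex := [set s | mdeg s = k].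

(* Hence the sums \sum_(s \in shell k) are genuine finite sums, not the default
   value 0 of sums with infinite support. *)
Lemma finite_shell (k : nat) : finite_set (shell k).
Proof.
pose f (t : {ffun 'I_d -> 'I_k.+1}) : multiindex := [ffun j => t j : nat].
apply: (@sub_finite_set _ _ (f @` setT)); last exact/finite_image.
move=> s sk; exists [ffun j => inord (s j)] => //.
apply/ffunP => j; rewrite !ffunE inordK// ltnS -sk.
by rewrite /mdeg (bigD1 j)//= leq_addr.
Qed.

End MultiIndices.

(* The complex notions are stated over an arbitrary numClosedFieldType C with
   its norm topology; they are used at C = cplx R. *)
Section PowerSeries.
Variables (C : numClosedFieldType) (d : nat).
Implicit Types (a : multiindex d -> C) (z p x : 'rV[C]_d).
Implicit Types (U : set 'rV[C]_d) (f G H P Q : 'rV[C]_d -> C).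

Definition monom z (s : multiindex d) : C := \prod_j z 0 j ^+ s j.

(* Absolute convergence: as the terms are nonnegative, grouping them by total
   degree does not matter. *)
Definition mps_cvg a z : Prop :=
  cvgn (series (fun k => \sum_(s \in shell k) `|a s * monom z s|)).

(* Meaningful only when [mps_cvg a z]. *)
Definition mps_sum a z : C :=
  limn (series (fun k => \sum_(s \in shell k) (a s * monom z s))).

Definition conv_domain a : set 'rV[C]_d := interior [set z | mps_cvg a z].

Definition analytic_at f p : Prop :=
  exists c, \forall z \near p, mps_cvg c (z - p) /\ f z = mps_sum c (z - p).

Definition analytic_on U f : Prop := forall p, U p -> analytic_at f p.

Definition polydisk x : set 'rV[C]_d :=
  [set z | forall j, `|z 0 j| <= `|x 0 j|].

(* Divisibility in the ring of analytic functions on U. *)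
Definition dvd_on U P Q : Prop :=
  exists2 K, analytic_on U K & forall z, U z -> Q z = P z * K z.

Definition unit_on U P : Prop := dvd_on U P (fun=> 1).

Definition relatively_prime_on U G H : Prop :=
  forall P, analytic_on U P -> dvd_on U P G -> dvd_on U P H -> unit_on U P.

Definition square_free_on U H : Prop :=
  forall P, analytic_on U P -> dvd_on U (fun z => P z * P z) H -> unit_on U P.

Definition dir_vec H x : 'rV[C]_d :=
  \row_j (x 0 j * 'D_(delta_mx 0 j) H x).

End PowerSeries.

Section OneVariable.
Variable C : numClosedFieldType.

Definition analytic1_at (f : C -> C) (p : C) : Prop :=
  exists c : nat -> C, \forall z \near p,
    series (fun n => c n * (z - p) ^+ n) @ \oo --> f z.

(* f has domain Om, containing a neighbourhood of 0.  The germ of f at 0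
   extends to a function g that is analytic at every point of the closed disk
   of radius |x0| except x0, where g has a simple pole. *)
Definition unique_min_singularity_simple_pole
    (Om : set C) (f : C -> C) (x0 : C) : Prop :=
  exists g : C -> C,
  [/\ \forall z \near (0 : C), Om z /\ f z = g z,
      forall z, `|z| <= `|x0| -> z != x0 -> analytic1_at g z
    & exists h : C -> C,
      [/\ analytic1_at h x0, h x0 != 0
        & \forall z \near x0, z != x0 -> g z = h z / (z - x0)]].

End OneVariable.

Section RealSide.
Variables (R : realType) (d : nat).

Definition log_domain (D : set 'rV[cplx R]_d) : set 'rV[R]_d :=
  [set y | D (\row_j ofreal (expR (y 0 j)))].

Definition boundary (A : set 'rV[R]_d) : set 'rV[R]_d :=
  closure A `\` interior A.

Definition segment (p q : 'rV[R]_d) : set 'rV[R]_d :=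
  [set (1 - t) *: p + t *: q | t in `[0, 1]].

Definition strictly_convex (A : set 'rV[R]_d) : Prop :=
  forall p q, p != q -> ~ (segment p q `<=` boundary A).

(* r is a representative, with nonnegative real coordinates, of the complex
   projective class of v. *)
Definition nonneg_representative (v : 'rV[cplx R]_d) (r : 'rV[R]_d) : Prop :=
  (forall j, 0 <= r 0 j) /\
  exists2 c : cplx R, c != 0 & forall j, ofreal (r 0 j) = c * v 0 j.

Definition norm1 (r : 'rV[R]_d) : R := \sum_j `|r 0 j|.

Definition shell_mass (a : multiindex d -> R) (k : nat) : R :=
  \sum_(s \in shell k) a s.

Definition mu (a : multiindex d -> R) (k : nat) (A : set (multiindex d)) : R :=
  \sum_(s \in shell k `&` A) (a s / shell_mass a k).

Definition scaled (k : nat) (s : multiindex d) : 'rV[R]_d :=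
  \row_j ((s j)%:R / k%:R).

Definition weak_law (a : multiindex d -> R) (m : 'rV[R]_d) : Prop :=
  forall eps : R, 0 < eps ->
    (fun k => mu a k [set s | norm1 (scaled k s - m) > eps]) @ \oo --> (0 : R).

End RealSide.

(* Main.v *)
(** Along the diagonal, [x0 - t] times [F (t, ..., t)] continues analytically past the
    closed disk of radius [|x0|], so [shell_mass a k * x0 ^+ k] converges to a nonzero
    limit; in particular [x0 > 0].  Multiply the [j]-th coordinate of [x] by [exp t] and
    let [rho] be the radius of convergence of [F] along that ray.  By Pringsheim's theorem
    [H] vanishes at the point [rho] of the ray; linearizing [H] at [x] gives
    [rho = 1 - t p_j + O(t^2)], where [p_j] is the [j]-th entry of the normalized
    direction.  As [rho] controls the generating function of [s_j] under [mu a k],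
    Chernoff's bound for small [t] of both signs concentrates [s_j / k] at [p_j]. *)
Require Import Defs.
From HB Require Import structures.
From mathcomp Require Import all_boot all_order all_algebra.
From mathcomp Require Import all_classical all_reals all_analysis.
From mathcomp Require Import finmap.
From mathcomp.real_closed Require Import complex.
From mathcomp Require Import ring lra.
From mathcomp Require cyclic separable cyclotomic.

Set Implicit Arguments.
Unset Strict Implicit.
Unset Printing Implicit Defensive.

Import Order.TTheory GRing.Theory Num.Theory.
Import numFieldNormedType.Exports.

Local Open Scope classical_set_scope.
Local Open Scope ring_scope.

(** Several variables enter only through complex lines through the origin, where F becomes a
    one-variable series with coefficients [wmass]. The obstacle is that F is tied to G / H only
    inside D, while the zero of H is wanted on the boundary and at a tilted point that may lie
    outside the polydisk. Pringsheim's argument needs the quotient only near one positive point of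
    the ray, and openness of U at x supplies G and H there if that point is close to x. The diagonal
    asymptotics provide this closeness. The products [shell_mass a k * X ^+ k] are bounded, and
    bounded below for large k; since 0 <= s_j <= k, tilting changes the radius 1 by at most the
    factor exp |t|. So the zero of H moves by O(|t|), and a first-order expansion of H determines
    rho up to O(t^2). That p_j is real and nonnegative is a conclusion: rho is real, and at most 1
    for t >= 0. No contour integral occurs: Cauchy's estimate comes from roots of unity, and
    continuation proceeds by steps of fixed length, from geometric bounds on Taylor coefficients
    that are uniform on the disk. *)

Section Modulus.
Variable R : realType.
Implicit Types (t e : R) (z p : cplx R).

(** * The real embedding and the real-valued modulus *)

HB.instance Definition _ := GRing.isZmodMorphism.Build R (cplx R) (@ofreal R)
  (@real_complex_is_additive R).
Fact ofreal_monoid_morphism : monoid_morphism (@ofreal R).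
Proof. by case: (@real_complex_is_multiplicative R) => h h1; split. Qed.

HB.instance Definition _ := GRing.isMonoidMorphism.Build R (cplx R) (@ofreal R)
  ofreal_monoid_morphism.

(** The norm of [cplx R] takes values in [cplx R]; this copy lies in [R], where the order is total
    and [lra] and suprema are available. *)
Definition cmod z : R := ComplexField.Normc.normc (z : R[i]).
Arguments cmod : simpl never.

Lemma ofreal_cmod z : `|z| = ofreal (cmod z).
Proof. by []. Qed.

Lemma ofrealI : injective (@ofreal R).
Proof. exact: fmorph_inj. Qed.

Lemma ltr_ofreal t e : (ofreal t < ofreal e) = (t < e).
Proof. exact: ltcR. Qed.

Lemma ler_ofreal t e : (ofreal t <= ofreal e) = (t <= e).
Proof. exact: lecR. Qed.

Lemma cmod_ge0 z : 0 <= cmod z.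
Proof. by rewrite -ler_ofreal -ofreal_cmod rmorph0. Qed.

Lemma cmodM z p : cmod (z * p) = cmod z * cmod p.
Proof. exact: ComplexField.Normc.normcM. Qed.

Lemma cmod_eq0 z : (cmod z == 0) = (z == 0).
Proof. by rewrite -(inj_eq ofrealI) -ofreal_cmod rmorph0 normr_eq0. Qed.

Lemma cmod0 : cmod 0 = 0.
Proof. by apply/eqP; rewrite cmod_eq0. Qed.

Lemma cmod_gt0 z : (0 < cmod z) = (z != 0).
Proof. by rewrite lt_def cmod_ge0 andbT cmod_eq0. Qed.

Lemma cmodN z : cmod (- z) = cmod z.
Proof. by apply: ofrealI; rewrite -!ofreal_cmod normrN. Qed.

Lemma cmod_distrC z p : cmod (z - p) = cmod (p - z).
Proof. by rewrite -cmodN opprB. Qed.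

Lemma cmod_ofreal t : cmod (ofreal t) = `|t|.
Proof. by rewrite /cmod /ofreal /= expr0n addr0 sqrtr_sqr. Qed.

Lemma cmod1 : cmod 1 = 1.
Proof. by rewrite -[X in cmod X](rmorph1 (@ofreal R)) cmod_ofreal normr1. Qed.

Lemma cmod_nat n : cmod n%:R = n%:R.
Proof. by rewrite -(rmorph_nat (@ofreal R)) cmod_ofreal normr_nat. Qed.

Lemma cmodV z : cmod z^-1 = (cmod z)^-1.
Proof. exact: ComplexField.Normc.normcV. Qed.

Lemma cmodX z n : cmod (z ^+ n) = cmod z ^+ n.
Proof. by elim: n => [|n IH]; rewrite ?cmod1// !exprS cmodM IH. Qed.

Lemma cmod_prod (I : Type) (s : seq I) (P : pred I) (u : I -> cplx R) :
  cmod (\prod_(i <- s | P i) u i) = \prod_(i <- s | P i) cmod (u i).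
Proof. by apply: (big_morph cmod cmodM cmod1). Qed.

Lemma cmodD z p : cmod (z + p) <= cmod z + cmod p.
Proof. by rewrite -ler_ofreal rmorphD/= -!ofreal_cmod ler_normD. Qed.

Lemma cmodB z p : cmod (z - p) <= cmod z + cmod p.
Proof. by rewrite -(cmodN p) cmodD. Qed.

Lemma cmodB_ge z p : cmod z - cmod p <= cmod (z - p).
Proof. by rewrite lerBlDr -{1}(subrK p z) cmodD. Qed.

Lemma cmod_dist3 p z z' : cmod (z - z') <= cmod (z - p) + cmod (p - z').
Proof. by rewrite -{1}(subrK p z) -addrA cmodD. Qed.

Lemma cmod_sum (I : Type) (s : seq I) (P : pred I) (u : I -> cplx R) :
  cmod (\sum_(i <- s | P i) u i) <= \sum_(i <- s | P i) cmod (u i).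
Proof.
elim/big_rec2: _ => [|i x y _ h]; first by rewrite cmod0.
by apply: (le_trans (cmodD _ _)); rewrite lerD2l.
Qed.

Lemma Re_le_cmod z : `|complex.Re z| <= cmod z.
Proof. by rewrite -ler_ofreal -ofreal_cmod; exact: normc_ge_Re. Qed.

Lemma Im_le_cmod z : `|complex.Im z| <= cmod z.
Proof.
rewrite -[complex.Im z]opprK -ReiNIm normrN.
apply: (le_trans (Re_le_cmod _)).
by rewrite cmodM /cmod /= expr0n add0r expr1n sqrtr1 mulr1.
Qed.

Lemma cmod_le_ReIm z : cmod z <= `|complex.Re z| + `|complex.Im z|.
Proof.
have {1}-> : z = ofreal (complex.Re z) + Complex 0 1 * ofreal (complex.Im z).
  case: (z) => u v; apply/eqP; rewrite [_ == _]eq_complex /=.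
  by rewrite !mul1r !mul0r subr0 addr0 !add0r !eqxx.
apply: (le_trans (cmodD _ _)); rewrite cmodM !cmod_ofreal.
by rewrite /cmod /= expr0n add0r expr1n sqrtr1 mul1r.
Qed.

Lemma ler_norm_cmod z p : (`|z| <= `|p|) = (cmod z <= cmod p).
Proof. by rewrite !ofreal_cmod ler_ofreal. Qed.

Lemma gt0_ofrealP (e : cplx R) : 0 < e -> exists2 t : R, 0 < t & e = ofreal t.
Proof.
move=> e0; exists (complex.Re e); last by rewrite /ofreal; rewrite RRe_real// gtr0_real.
by move: e0; rewrite ltcE => /andP[].
Qed.

Lemma near_cplxP (P : set (cplx R)) p :
  (\forall z \near p, P z) <->
  exists2 e : R, 0 < e & forall z, cmod (z - p) < e -> P z.
Proof.
split=> [/nbhs_ballP[e /= /gt0_ofrealP[t t0 ->] h]|[e e0 h]].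
  exists t => // z zp; apply: h; rewrite -ball_normE /= ofreal_cmod ltr_ofreal.
  by rewrite cmod_distrC.
apply/nbhs_ballP; exists (ofreal e); first by rewrite /= -(rmorph0 (@ofreal R)) ltr_ofreal.
move=> z; rewrite -ball_normE /= ofreal_cmod ltr_ofreal => zp.
by apply: h; rewrite cmod_distrC.
Qed.

Lemma cvg_cplxP (u : nat -> cplx R) (l : cplx R) :
  (u @ \oo --> l) <-> ((fun n => cmod (u n - l)) @ \oo --> (0 : R)).
Proof.
split=> [/cvgrPdist_lt h|/cvgrPdist_lt h]; apply/cvgrPdist_lt => e e0.
  have e0' : 0 < ofreal e by rewrite -(rmorph0 (@ofreal R)) ltr_ofreal.
  have := h _ e0'; apply: filterS => n.
  by rewrite ofreal_cmod ltr_ofreal sub0r normrN ger0_norm ?cmod_ge0// cmod_distrC.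
have [t t0 ->] := gt0_ofrealP e0.
have := h _ t0; apply: filterS => n.
by rewrite ofreal_cmod ltr_ofreal sub0r normrN ger0_norm ?cmod_ge0// cmod_distrC.
Qed.

Lemma near_row_cplxP d (P : set 'rV[cplx R]_d) (p : 'rV[cplx R]_d) :
  (\forall z \near p, P z) <->
  exists2 e : R, 0 < e & forall z : 'rV[cplx R]_d, (forall j, cmod (z 0 j - p 0 j) < e) -> P z.
Proof.
split=> [/nbhs_ballP[e /= /gt0_ofrealP[t t0 ->] h]|[e e0 h]].
  exists t => // z zp; apply: h; split; first by rewrite -(rmorph0 (@ofreal R)) ltr_ofreal.
  move=> i j; rewrite (ord1 i).
  by rewrite -ball_normE /= ofreal_cmod ltr_ofreal cmod_distrC.
apply/nbhs_ballP; exists (ofreal e); first by rewrite /= -(rmorph0 (@ofreal R)) ltr_ofreal.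
move=> z [_ zp]; apply: h => j; have := zp 0 j.
by rewrite -ball_normE /= ofreal_cmod ltr_ofreal cmod_distrC.
Qed.

End Modulus.
Arguments cmod {R} z : simpl never.

(** * Absolutely convergent complex series and exchange of double sums *)

Section Summation.
Variable R : realType.
Local Notation C := (cplx R).
Implicit Types (u v : nat -> C) (l : C) (B e : R).

(** A total function; by [csum_unique] it is the sum as soon as the partial sums converge, in
    particular under [asum]. *)
Definition csum u : C :=
  Complex (limn (series (fun n => complex.Re (u n))))
          (limn (series (fun n => complex.Im (u n)))).

Definition asum_le u B := forall n, \sum_(i < n) cmod (u i) <= B.

Definition asum u := exists B, asum_le u B.

Lemma Re_sum u n : complex.Re (\sum_(i < n) u i) = \sum_(i < n) complex.Re (u i).
Proof. by elim: n => [|n IH]; rewrite ?big_ord0// !big_ord_recr /= -IH; case: (\sum_(i < n) _) (u n) => ? ? []. Qed.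

Lemma Im_sum u n : complex.Im (\sum_(i < n) u i) = \sum_(i < n) complex.Im (u i).
Proof. by elim: n => [|n IH]; rewrite ?big_ord0// !big_ord_recr /= -IH; case: (\sum_(i < n) _) (u n) => ? ? []. Qed.

Lemma ReB (z p : C) : complex.Re (z - p) = complex.Re z - complex.Re p.
Proof. by case: z => ? ?; case: p. Qed.

Lemma ImB (z p : C) : complex.Im (z - p) = complex.Im z - complex.Im p.
Proof. by case: z => ? ?; case: p. Qed.

Lemma cvg_bounded_asum (w : nat -> R) B :
  (forall n, \sum_(i < n) `|w i| <= B) -> cvgn (series w).
Proof.
move=> h; apply: normed_cvg; apply: nondecreasing_is_cvgn.
  apply/nondecreasing_seqP => n; rewrite /normed_series_of !seriesEord /= big_ord_recr /=.
  by rewrite lerDl.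
exists B => y [n _ <-]; rewrite /normed_series_of seriesEord /=.
exact: h.
Qed.

Lemma asum_csum_cvg u : asum u ->
  (fun n => cmod (\sum_(i < n) u i - csum u)) @ \oo --> (0 : R).
Proof.
move=> [B uB].
have cRe : cvgn (series (fun n => complex.Re (u n))).
  apply: (@cvg_bounded_asum _ B) => n; apply: le_trans (uB n).
  by apply: ler_sum => i _; exact: Re_le_cmod.
have cIm : cvgn (series (fun n => complex.Im (u n))).
  apply: (@cvg_bounded_asum _ B) => n; apply: le_trans (uB n).
  by apply: ler_sum => i _; exact: Im_le_cmod.
apply: (@squeeze_cvgr _ _ _ _ (fun=> 0)
    (fun n => `|series (fun n => complex.Re (u n)) n - complex.Re (csum u)| +
              `|series (fun n => complex.Im (u n)) n - complex.Im (csum u)|)).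
- apply: nearW => n; rewrite cmod_ge0 /=; apply: (le_trans (cmod_le_ReIm _)).
  by rewrite ReB ImB Re_sum Im_sum /csum /= !seriesEord lexx.
- exact: (cvg_cst (0 : R)).
- have H (s : nat -> R) (l : R) : s @ \oo --> l -> (fun n => `|s n - l|) @ \oo --> (0 : R).
    move=> /cvgrPdist_lt sl; apply/cvgrPdist_lt => e e0.
    by apply: filterS (sl e e0) => n; rewrite sub0r normrN normr_id distrC.
  rewrite -[X in _ --> X]addr0; apply: cvgD; [exact: H cRe|exact: H cIm].
Qed.

Lemma csum_unique u l :
  (fun n => cmod (\sum_(i < n) u i - l)) @ \oo --> (0 : R) -> csum u = l.
Proof.
move=> h.
have H (F : C -> R) (FB : forall z p, F (z - p) = F z - F p)
    (Fs : forall u n, F (\sum_(i < n) u i) = \sum_(i < n) F (u i))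
    (Fle : forall z, `|F z| <= cmod z) : limn (series (fun n => F (u n))) = F l.
  apply/cvg_lim => //.
  apply/cvgrPdist_lt => e e0; move/cvgrPdist_lt: h => /(_ e e0); apply: filterS => n.
  rewrite sub0r normrN ger0_norm ?cmod_ge0//; apply: le_lt_trans.
  by rewrite seriesEord /= -Fs -FB cmod_distrC Fle.
rewrite /csum (H _ ReB Re_sum (@Re_le_cmod R)) (H _ ImB Im_sum (@Im_le_cmod R)).
by case: l {h H}.
Qed.

Lemma csum_near u e : asum u -> 0 < e ->
  exists N, forall n, (N <= n)%N -> cmod (\sum_(i < n) u i - csum u) < e.
Proof.
move=> /asum_csum_cvg /cvgrPdist_lt h /h[N _ hN]; exists N => n /hN.
by rewrite sub0r normrN ger0_norm ?cmod_ge0.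
Qed.

Lemma csum_uniqueP u l :
  (forall e, 0 < e -> exists N, forall n, (N <= n)%N ->
     cmod (\sum_(i < n) u i - l) <= e) -> csum u = l.
Proof.
move=> h; apply: csum_unique; apply/cvgrPdist_le => e e0.
have [N hN] := h _ e0; exists N => // n /hN.
by rewrite sub0r normrN ger0_norm ?cmod_ge0.
Qed.

Lemma csum_dist_le u l e N : asum u ->
  (forall n, (N <= n)%N -> cmod (\sum_(i < n) u i - l) <= e) -> cmod (csum u - l) <= e.
Proof.
move=> su h; rewrite leNgt; apply/negP => elt.
have [M hM] := csum_near su (etrans (subr_gt0 _ _) elt).
have := hM (maxn N M) (leq_maxr _ _); apply/negP; rewrite -leNgt lerBlDr.
apply: (le_trans (cmod_dist3 (\sum_(i < maxn N M) u i) _ _)).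
by rewrite cmod_distrC lerD2l h// leq_maxl.
Qed.

Lemma cmod_csum_le u B : asum_le u B -> cmod (csum u) <= B.
Proof.
move=> h; rewrite -[csum u]subr0; apply: (@csum_dist_le _ _ _ 0); first by exists B.
by move=> n _; rewrite subr0; apply: (le_trans (cmod_sum _ _ _)).
Qed.

Lemma asum0 : asum (fun=> 0).
Proof. by exists 0 => n; rewrite big1// => i _; rewrite cmod0. Qed.

Lemma asumD u v : asum u -> asum v -> asum (fun n => u n + v n).
Proof.
move=> [A hA] [B hB]; exists (A + B) => n; apply: le_trans (lerD (hA n) (hB n)).
by rewrite -big_split; apply: ler_sum => i _; exact: cmodD.
Qed.

Lemma asumZ l u : asum u -> asum (fun n => l * u n).
Proof.
move=> [A hA]; exists (cmod l * A) => n.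
under eq_bigr do rewrite cmodM.
by rewrite -mulr_sumr ler_wpM2l ?cmod_ge0.
Qed.

Lemma asum_sum (k : nat) (w : nat -> nat -> C) : (forall i, (i < k)%N -> asum (w i)) ->
  asum (fun n => \sum_(i < k) w i n).
Proof.
elim: k => [|k IH] h.
  by have [B hB] := asum0; exists B => n; under eq_bigr do rewrite big_ord0; exact: hB.
have [B hB] := asumD (IH (fun i ik => h i (ltnW ik))) (h k (ltnSn k)).
by exists B => n; under eq_bigr do rewrite big_ord_recr; exact: hB.
Qed.

Lemma asum_le_trans u v : (forall n, cmod (u n) <= cmod (v n)) -> asum v -> asum u.
Proof.
by move=> h [B hB]; exists B => n; apply: le_trans (hB n); exact: ler_sum.
Qed.

Lemma eq_csum u v : u =1 v -> csum u = csum v.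
Proof. by move=> /funext ->. Qed.

Lemma csumD u v : asum u -> asum v -> csum (fun n => u n + v n) = csum u + csum v.
Proof.
move=> su sv; apply: csum_uniqueP => e e0.
have [N hN] := csum_near su (divr_gt0 e0 (ltr0n _ 2)).
have [M hM] := csum_near sv (divr_gt0 e0 (ltr0n _ 2)).
exists (maxn N M) => n; rewrite geq_max => /andP[Nn Mn].
rewrite big_split /= opprD addrACA [e]splitr.
by apply: (le_trans (cmodD _ _)); rewrite lerD// ltW// ?hN ?hM.
Qed.

Lemma csumZ l u : asum u -> csum (fun n => l * u n) = l * csum u.
Proof.
move=> su; apply: csum_uniqueP => e e0.
have k0 : 0 < cmod l + 1 by rewrite ltr_wpDl ?cmod_ge0.
have [N hN] := csum_near su (divr_gt0 e0 k0).
exists N => n Nn; rewrite -mulr_sumr -mulrBr cmodM.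
apply: (@le_trans _ _ ((cmod l + 1) * (e / (cmod l + 1)))).
  by apply: ler_pM; rewrite ?cmod_ge0// ?lerDl// ltW// hN.
by rewrite mulrC divfK// gt_eqF.
Qed.

Lemma csum_finite u n : (forall i, (n <= i)%N -> u i = 0) -> csum u = \sum_(i < n) u i.
Proof.
move=> h; apply: csum_uniqueP => e e0; exists n => m nm.
rewrite -(subnKC nm) big_split_ord /= addrAC subrr add0r big1 ?cmod0 ?ltW//.
by move=> i _; apply: h; exact: leq_addr.
Qed.

Lemma asum_shift u n : asum u -> asum (fun i => u (n + i)%N).
Proof.
move=> [B hB]; exists B => m; apply: le_trans (hB (n + m)%N).
rewrite big_split_ord /= lerDr; apply: sumr_ge0 => i _; exact: cmod_ge0.
Qed.

Lemma csum_split u n : asum u -> csum u = \sum_(i < n) u i + csum (fun i => u (n + i)%N).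
Proof.
move=> su; apply: csum_uniqueP => e e0.
have [N hN] := csum_near (asum_shift n su) e0.
exists (n + N)%N => m nNm.
have nm : (n <= m)%N by apply: leq_trans nNm; exact: leq_addr.
rewrite -(subnKC nm) big_split_ord /= addrC addrKA ltW// hN//.
by rewrite leq_subRL.
Qed.

Lemma csum_sum (k : nat) (w : nat -> nat -> C) : (forall i, (i < k)%N -> asum (w i)) ->
  csum (fun n => \sum_(i < k) w i n) = \sum_(i < k) csum (w i).
Proof.
elim: k => [|k IH] h.
  rewrite big_ord0 (@csum_finite _ 0) ?big_ord0// => i _; exact: big_ord0.
rewrite big_ord_recr /= -IH => [|i ik]; last by apply: h; exact: ltnW.
rewrite -csumD//; last exact: h.
  by apply: eq_csum => n; rewrite big_ord_recr.
by apply: asum_sum => i ik; apply: h; exact: ltnW.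
Qed.

Definition asum2_le (w : nat -> nat -> C) B :=
  forall m n, \sum_(i < m) \sum_(j < n) cmod (w i j) <= B.

Lemma asum2_row w B i : asum2_le w B -> asum_le (w i) B.
Proof.
move=> h n; apply: le_trans (h i.+1 n).
rewrite big_ord_recr /= lerDr; apply: sumr_ge0 => j _.
by apply: sumr_ge0 => k _; exact: cmod_ge0.
Qed.

Lemma asum2_tr w B : asum2_le w B -> asum2_le (fun i j => w j i) B.
Proof. by move=> h m n; rewrite exchange_big. Qed.

Lemma asum2_csum w B : asum2_le w B -> asum_le (fun i => csum (w i)) B.
Proof.
move=> h n; rewrite leNgt; apply/negP => lt.
(* The excess over B is cut into n + 1 shares; an error of one share in each of n rows cannot make
   up for it. *)
pose e := ((\sum_(i < n) cmod (csum (w i))) - B) / (n.+1%:R).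
have e0 : 0 < e by rewrite divr_gt0// subr_gt0.
have {}su i : asum (w i) by exists B; exact: asum2_row h.
have [N hN] : exists N, forall i : 'I_n, cmod (csum (w i)) <= \sum_(j < N) cmod (w i j) + e.
  have F i : exists N, forall M, (N <= M)%N -> cmod (csum (w i)) <= \sum_(j < M) cmod (w i j) + e.
    have [N hN] := csum_near (su i) e0; exists N => M /hN /ltW.
    rewrite cmod_distrC -lerBlDl; apply: le_trans.
    by apply: le_trans (cmodB_ge _ _); rewrite lerD2l lerN2 cmod_sum.
  pose N i := projT1 (cid (F i)).
  exists (\max_(i < n) N i)%N => i; apply: (projT2 (cid (F i))).
  by have := @leq_bigmax 'I_n (fun i : 'I_n => N i) i.
have : \sum_(i < n) cmod (csum (w i)) <= B + e *+ n.
  apply: (@le_trans _ _ (\sum_(i < n) (\sum_(j < N) cmod (w i j) + e))).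
    by apply: ler_sum => i _; apply: hN.
  rewrite big_split /= sumr_const card_ord lerD2r; exact: h.
apply/negP; rewrite -ltNge -ltrBrDl -mulr_natr /e.
rewrite -mulrA gtr_pMr ?subr_gt0//.
by rewrite mulrC ltr_pdivrMr// mul1r ltr_nat.
Qed.

(** A rectangle carrying all but e of the absolute mass determines the iterated sum up to e. The
    hypothesis mentions finite rectangles only, so it serves the transposed array as well. *)
Lemma csum2_near w B m n e : asum2_le w B ->
  (forall m' n', \sum_(i < m') \sum_(j < n') cmod (w i j) <=
                 \sum_(i < m) \sum_(j < n) cmod (w i j) + e) ->
  cmod (csum (fun i => csum (w i)) - \sum_(i < m) \sum_(j < n) w i j) <= e.
Proof.
move=> wB h.
have sw i : asum (w i) by exists B; exact: asum2_row wB.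
apply: (@csum_dist_le _ _ _ m); first by exists B; exact: asum2_csum.
move=> m' mm; rewrite -csum_sum//.
apply: (@csum_dist_le _ _ _ n); first by apply: asum_sum => i _; exact: sw.
move=> n' nn; rewrite exchange_big /=.
(* The larger rectangle minus the smaller one is an L-shaped region. V is free because the identity
   is used for the terms in [C] and for their moduli in [R]. *)
have E (V : fieldType) (c : nat -> nat -> V) :
    \sum_(i < m') \sum_(j < n') c i j - \sum_(i < m) \sum_(j < n) c i j =
    \sum_(i < m) \sum_(j < n' - n) c i (n + j)%N + \sum_(i < m' - m) \sum_(j < n') c (m + i)%N j.
  have S (f : nat -> V) (q q' : nat) : (q <= q')%N ->
      \sum_(i < q') f i = \sum_(i < q) f i + \sum_(i < q' - q) f (q + i)%N.
    by move=> qq; rewrite -[in LHS](subnKC qq) big_split_ord.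
  rewrite (S (fun i => \sum_(j < n') c i j) _ _ mm).
  under [X in X + _ - _]eq_bigr do rewrite (S _ _ _ nn).
  rewrite big_split /=; ring.
rewrite E; apply: (@le_trans _ _ (\sum_(i < m') \sum_(j < n') cmod (w i j) - \sum_(i < m) \sum_(j < n) cmod (w i j))); last by rewrite lerBlDl.
rewrite (E R (fun i j => cmod (w i j))).
apply: (le_trans (cmodD _ _)); apply: lerD; apply: (le_trans (cmod_sum _ _ _)).
  by apply: ler_sum => i _; exact: cmod_sum.
by apply: ler_sum => i _; exact: cmod_sum.
Qed.

(* Both iterated sums are within e of the sum over a large enough rectangle. *)
Lemma csum_exchange w B : asum2_le w B ->
  csum (fun i => csum (w i)) = csum (fun j => csum (fun i => w i j)).
Proof.
move=> wB; apply/eqP; rewrite -subr_eq0 -cmod_eq0 eq_le cmod_ge0 andbT.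
apply/ler_addgt0Pl => e e0; rewrite addr0.
pose A := [set x : R | exists m n, x = \sum_(i < m) \sum_(j < n) cmod (w i j)].
have hA : has_sup A.
  split; first by exists (\sum_(i < 0) \sum_(j < 0) cmod (w i j)), 0%N, 0%N.
  by exists B => _ [m [n ->]].
have [_ [m [n ->]] mn] := sup_adherent (divr_gt0 e0 (ltr0n _ 2)) hA.
have k m' n' : \sum_(i < m') \sum_(j < n') cmod (w i j) <=
                 \sum_(i < m) \sum_(j < n) cmod (w i j) + e / 2.
  rewrite -lerBlDr; apply: (le_trans _ (ltW mn)); rewrite lerD2r.
  by apply: sup_ubound; [exact: hA.2|exists m', n'].
apply: (le_trans (cmod_dist3 (\sum_(i < m) \sum_(j < n) w i j) _ _)).
rewrite [e]splitr; apply: lerD; first exact: csum2_near wB k.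
rewrite cmod_distrC exchange_big /=; apply: (csum2_near (asum2_tr wB)) => n' m'.
by rewrite exchange_big [X in _ <= X + _]exchange_big.
Qed.

End Summation.
Arguments csum {R} u : simpl never.

(** * Power series in one variable: re-expansion, Cauchy's estimate, products *)

Section UnivariateSeries.
Variable R : realType.
Local Notation C := (cplx R).
Implicit Types (c : nat -> C) (z p h : C) (r s M B e : R).

(** Bounded terms at radius r: for positive r, existence of M says that the radius of convergence is
    at least r. Absolute convergence follows on the open disk, hence the strict inequalities and
    shrunken radii below. *)
Definition pbnd c r M := forall n, cmod (c n) * r ^+ n <= M.

Definition psum c z : C := csum (fun n => c n * z ^+ n).

(** The coefficients of the series re-expanded at p. Truncated subtraction is harmless: the binomial
    coefficient vanishes for m < n. *)
Definition taylor c p (n : nat) : C :=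
  csum (fun m => 'C(m, n)%:R * c m * p ^+ (m - n)).

Definition conv c c' (n : nat) : C := \sum_(i < n.+1) c i * c' (n - i)%N.

Lemma geo_sum_le (x : R) n : 0 <= x < 1 -> \sum_(i < n) x ^+ i <= (1 - x)^-1.
Proof.
move=> /andP[x0 x1]; rewrite -[leRHS]mul1r ler_pdivlMr ?subr_gt0//.
rewrite mulrC -opprB mulNr -subrX1 opprB lerBlDr lerDl; exact: exprn_ge0.
Qed.

Lemma pbnd_ge0 c r M : 0 <= r -> pbnd c r M -> 0 <= M.
Proof. by move=> r0 /(_ 0%N); apply: le_trans; rewrite mulr_ge0 ?cmod_ge0 ?exprn_ge0. Qed.

Lemma pbnd_sub c r s M : 0 <= s <= r -> pbnd c r M -> pbnd c s M.
Proof.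
move=> /andP[s0 sr] h n; apply: le_trans (h n).
by rewrite ler_wpM2l ?cmod_ge0// lerXn2r// ?nnegrE// (le_trans s0).
Qed.

Lemma pbnd_sum_le c r M s n : 0 < r -> pbnd c r M -> 0 <= s < r ->
  \sum_(i < n) cmod (c i) * s ^+ i <= M / (1 - s / r).
Proof.
move=> r0 h /andP[s0 sr].
have sr1 : 0 <= s / r < 1.
  by apply/andP; split; [exact: divr_ge0 s0 (ltW r0)|rewrite ltr_pdivrMr// mul1r].
apply: (@le_trans _ _ (\sum_(i < n) M * (s / r) ^+ i)).
  apply: ler_sum => i _.
  have -> : s ^+ i = (s / r) ^+ i * r ^+ i by rewrite -exprMn divfK// gt_eqF.
  rewrite mulrCA mulrC; apply: ler_wpM2r; last exact: h.
  by apply: exprn_ge0; case/andP: sr1.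
rewrite -mulr_sumr; apply: ler_wpM2l; first exact: pbnd_ge0 (ltW r0) h.
exact: geo_sum_le.
Qed.

Lemma pbnd_asum_le c r M z : 0 < r -> pbnd c r M -> cmod z < r ->
  asum_le (fun n => c n * z ^+ n) (M / (1 - cmod z / r)).
Proof.
move=> r0 h zr n; under eq_bigr do rewrite cmodM cmodX.
by apply: pbnd_sum_le; rewrite ?cmod_ge0.
Qed.

Lemma pbnd_asum c r M z : 0 < r -> pbnd c r M -> cmod z < r ->
  asum (fun n => c n * z ^+ n).
Proof. by move=> r0 h zr; eexists; exact: pbnd_asum_le r0 h zr. Qed.

Lemma psum_lip c r M h : 0 < r -> pbnd c r M -> cmod h <= r / 2 ->
  cmod (psum c h - c 0%N) <= 2 * M / r * cmod h.
Proof.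
move=> r0 cM hr.
have hr' : cmod h < r by apply: le_lt_trans hr _; lra.
rewrite /psum (csum_split 1 (pbnd_asum r0 cM hr')) big_ord1 expr0 mulr1 addrC addKr.
apply: cmod_csum_le => n.
have sM : pbnd (fun n => c n.+1) r (M / r).
  by move=> k; rewrite ler_pdivlMr// -mulrA -exprSr cM.
under eq_bigr do rewrite add1n exprSr mulrA cmodM.
rewrite -mulr_suml; apply: ler_wpM2r; first exact: cmod_ge0.
apply: le_trans (pbnd_asum_le r0 sM hr' n) _.
have M0 := pbnd_ge0 (ltW r0) cM.
have -> : 2 * M / r = M / r * 2 by ring.
apply: ler_wpM2l; first by rewrite divr_ge0// ltW.
rewrite invf_ple ?posrE//; last by rewrite subr_gt0 ltr_pdivrMr// mul1r.
by have : cmod h / r <= 2^-1; [rewrite ler_pdivrMr// mulrC|lra].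
Qed.

Lemma binom_partial (a b : R) m n : 0 <= a -> 0 <= b ->
  \sum_(i < n) 'C(m, i)%:R * a ^+ (m - i) * b ^+ i <= (a + b) ^+ m.
Proof.
move=> a0 b0.
have t0 i : 0 <= 'C(m, i)%:R * a ^+ (m - i) * b ^+ i.
  by rewrite !mulr_ge0 ?exprn_ge0// ler0n.
have -> : (a + b) ^+ m = \sum_(i < m.+1 + n) 'C(m, i)%:R * a ^+ (m - i) * b ^+ i.
  rewrite big_split_ord /= [X in _ = _ + X]big1 ?addr0 => [|i _]; last first.
    by rewrite bin_small ?mul0r// ltnS leq_addr.
  by rewrite exprDn; apply: eq_bigr => i _; rewrite -mulr_natl mulrA.
by rewrite addnC big_split_ord /= lerDl; apply: sumr_ge0 => i _.
Qed.

(** By the binomial theorem row m sums in modulus to at most |c_m| (|p| + |h|)^m, so a single series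
    inside the disk dominates the double family. *)
Lemma taylor_asum2 c r M p h : 0 < r -> pbnd c r M -> cmod p + cmod h < r ->
  asum2_le (fun m n => 'C(m, n)%:R * c m * p ^+ (m - n) * h ^+ n)
    (M / (1 - (cmod p + cmod h) / r)).
Proof.
move=> r0 cM phr m n.
apply: (@le_trans _ _ (\sum_(i < m) cmod (c i) * (cmod p + cmod h) ^+ i)); last first.
  by apply: pbnd_sum_le; rewrite // addr_ge0 ?cmod_ge0.
apply: ler_sum => i _.
apply: (@le_trans _ _ (cmod (c i) *
  \sum_(j < n) 'C(i, j)%:R * cmod p ^+ (i - j) * cmod h ^+ j)).
  rewrite mulr_sumr; apply: ler_sum => j _.
  rewrite !cmodM !cmodX cmod_nat le_eqVlt; apply/orP; left; apply/eqP; ring.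
by apply: ler_wpM2l; rewrite ?cmod_ge0// binom_partial ?cmod_ge0.
Qed.

Lemma taylor_asum c r M p n : 0 < r -> pbnd c r M -> cmod p < r ->
  asum (fun m => 'C(m, n)%:R * c m * p ^+ (m - n)).
Proof.
move=> r0 cM pr; pose s := (r - cmod p) / 2.
have s0 : 0 < s by rewrite divr_gt0// subr_gt0.
have h0 : cmod (ofreal s) = s by rewrite cmod_ofreal gtr0_norm.
have phr : cmod p + cmod (ofreal s) < r by rewrite h0 /s; lra.
have [] := @asumZ R ((ofreal s) ^- n)
   (fun m => 'C(m, n)%:R * c m * p ^+ (m - n) * ofreal s ^+ n).
  by eexists; exact: asum2_row (asum2_tr (taylor_asum2 r0 cM phr)).
move=> B hB; exists B => k; apply: le_trans (hB k); apply: ler_sum => i _.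
rewrite [in leRHS]mulrC mulfK// expf_neq0// -cmod_eq0 h0 gt_eqF//.
Qed.

Lemma taylor_term c r M p h n : 0 < r -> pbnd c r M -> cmod p < r ->
  csum (fun m => 'C(m, n)%:R * c m * p ^+ (m - n) * h ^+ n) = taylor c p n * h ^+ n.
Proof.
move=> r0 cM pr; rewrite mulrC -csumZ; first by apply: eq_csum => m; rewrite mulrC.
exact: taylor_asum cM pr.
Qed.

Lemma taylor_psum c r M p h : 0 < r -> pbnd c r M -> cmod p + cmod h < r ->
  psum c (p + h) = psum (taylor c p) h.
Proof.
move=> r0 cM phr.
have pr : cmod p < r by apply: le_lt_trans phr; rewrite lerDl cmod_ge0.
transitivity (csum (fun m => csum (fun n => 'C(m, n)%:R * c m * p ^+ (m - n) * h ^+ n))).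
  apply: eq_csum => m; rewrite (@csum_finite _ _ m.+1) => [|i mi]; last first.
    by rewrite bin_small// !mul0r.
  rewrite exprDn mulr_sumr; apply: eq_bigr => i _; rewrite -mulr_natl; ring.
rewrite (csum_exchange (taylor_asum2 r0 cM phr)); apply: eq_csum => n.
exact: taylor_term cM pr.
Qed.

Lemma taylor_pbnd c r M p s : 0 < r -> pbnd c r M -> 0 <= s -> cmod p + s < r ->
  pbnd (taylor c p) s (M / (1 - (cmod p + s) / r)).
Proof.
move=> r0 cM s0 psr n.
have hs : cmod (ofreal s) = s by rewrite cmod_ofreal ger0_norm.
have pr : cmod p < r by apply: le_lt_trans psr; rewrite lerDl.
have phr : cmod p + cmod (ofreal s) < r by rewrite hs.
have := asum2_csum (asum2_tr (taylor_asum2 r0 cM phr)) n.+1.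
rewrite hs; apply: le_trans; rewrite big_ord_recr /= [X in _ <= _ + cmod X](taylor_term _ n r0 cM pr).
rewrite cmodM cmodX hs lerDr; apply: sumr_ge0 => i _; exact: cmod_ge0.
Qed.

Lemma asum_tail (u : nat -> C) e : asum u -> 0 < e ->
  exists N, forall n, (N <= n)%N -> asum_le (fun i => u (n + i)%N) e.
Proof.
move=> [B uB] e0.
have su : asum (fun n => ofreal (cmod (u n))).
  exists B => n; under eq_bigr do rewrite cmod_ofreal ger0_norm ?cmod_ge0//.
  exact: uB.
have [N hN] := csum_near su (divr_gt0 e0 (ltr0n _ 2)).
exists N => n Nn m; have := hN (n + m)%N (leq_trans Nn (leq_addr _ _)).
have := hN _ Nn; set l := csum _ => h1 h2.
have : cmod (\sum_(i < n + m) ofreal (cmod (u i)) - \sum_(i < n) ofreal (cmod (u i))) <= e.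
  apply: le_trans (cmod_dist3 l _ _) _; rewrite [leRHS]splitr lerD// ltW//.
  by rewrite cmod_distrC.
rewrite -!rmorph_sum -rmorphB cmod_ofreal big_split_ord /= addrAC subrr add0r; apply: le_trans.
exact: ler_norm.
Qed.

Lemma prim_root_cplx n : (0 < n)%N -> exists w : C, n.-primitive_root w.
Proof.
move=> n0; pose p : {poly C} := 'X^n - 1.
have [rs Dp] := closed_field_poly_normal p.
rewrite (monicP _) ?monicXnsubC// scale1r in Dp.
have rn1 : all n.-unity_root rs.
  by apply/allP => z; rewrite -root_prod_XsubC -Dp.
have szrs : (n < (size rs).+1)%N.
  by rewrite -(size_prod_XsubC rs id) -Dp size_XnsubC.
have [|w] := hasP (cyclic.has_prim_root n0 rn1 _ szrs); last by exists w.
rewrite -separable.separable_prod_XsubC -Dp cyclotomic.separable_Xn_sub_1//.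
by rewrite pnatr_eq0 -lt0n.
Qed.

Lemma sum_unity_root (x : C) n : x ^+ n = 1 -> x != 1 -> \sum_(j < n) x ^+ j = 0.
Proof.
move=> xn x1; apply/eqP; have := subrX1 x n.
by rewrite xn subrr => /esym/eqP; rewrite mulf_eq0 subr_eq0 (negPf x1).
Qed.

(* Averaging the partial sum over the n-th roots of unity isolates one coefficient. *)
Lemma cauchy_estimate c r B k : 0 <= r -> asum (fun n => c n * ofreal r ^+ n) ->
  (forall z, cmod z = r -> cmod (psum c z) <= B) -> cmod (c k) * r ^+ k <= B.
Proof.
move=> r0 sc hB; apply/ler_addgt0Pr => e e0.
have [N hN] := asum_tail sc e0.
(* n > k leaves k as the only index below n that survives the averaging; n >= N makes the discarded
   tail at most e. *)
pose n := maxn N k.+1.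
have kn : (k < n)%N by rewrite leq_max leqnn orbT.
have n0 : (0 < n)%N by apply: leq_ltn_trans kn.
have [w wp] := prim_root_cplx n0.
have w1 : w ^+ n = 1 := prim_expr_order wp.
have cw : cmod w = 1.
  apply: (@pexpIrn _ n) => //; rewrite ?nnegrE ?cmod_ge0 ?ler01//.
  by rewrite -cmodX w1 cmod1 expr1n.
have wn0 : w != 0 by rewrite -cmod_eq0 cw oner_eq0.
have hP j : cmod (\sum_(i < n) c i * (ofreal r * w ^+ j) ^+ i) <= B + e.
  set z := ofreal r * w ^+ j.
  have cz : cmod z = r by rewrite cmodM cmodX cw expr1n mulr1 cmod_ofreal ger0_norm.
  have sz : asum (fun n => c n * z ^+ n).
    apply: asum_le_trans sc => i.
    by rewrite !cmodM !cmodX cz cmod_ofreal ger0_norm.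
  have := csum_split n sz; rewrite -/(psum c z) => /eqP; rewrite -subr_eq => /eqP <-.
  apply: (le_trans (cmodB _ _)); apply: lerD; first exact: hB.
  apply: cmod_csum_le => m; apply: le_trans (hN n (leq_maxl _ _) m).
  by apply: ler_sum => i _; rewrite !cmodM !cmodX cz cmod_ofreal ger0_norm.
have E : \sum_(j < n) (w ^- k) ^+ j * \sum_(i < n) c i * (ofreal r * w ^+ j) ^+ i
         = n%:R * (c k * ofreal r ^+ k).
  under eq_bigr do rewrite mulr_sumr.
  rewrite exchange_big /= (bigD1 (Ordinal kn))//= [X in _ + X]big1 ?addr0.
    rewrite (eq_bigr (fun=> c k * ofreal r ^+ k)) ?sumr_const ?card_ord ?mulr_natl// => j _.
    transitivity ((w ^- k) ^+ j * (w ^+ j) ^+ k * (c k * ofreal r ^+ k)).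
      by rewrite exprMn; ring.
    by rewrite exprVn -!exprM mulnC mulVf ?expf_neq0// mul1r.
  move=> i ik; pose x := w ^+ i / w ^+ k.
  have xn : x ^+ n = 1 by rewrite exprMn exprVn -!exprM !(mulnC _ n) !exprM w1 !expr1n invr1 mulr1.
  have x1 : x != 1.
    rewrite -subr_eq0 -(divff (expf_neq0 k wn0)) -mulrBl mulf_eq0 invr_eq0.
    rewrite (negPf (expf_neq0 k wn0)) orbF subr_eq0 (eq_prim_root_expr wp).
    by rewrite !modn_small.
  transitivity (\sum_(j < n) c i * ofreal r ^+ i * x ^+ j).
    apply: eq_bigr => j _; rewrite /x !exprMn -!exprM (mulnC i j); ring.
  by rewrite -mulr_sumr sum_unity_root// mulr0.
have nR : (0 : R) < n%:R by rewrite ltr0n.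
rewrite -(ler_pM2l nR).
have -> : n%:R * (cmod (c k) * r ^+ k) = cmod (n%:R * (c k * ofreal r ^+ k)).
  by rewrite !cmodM cmodX cmod_nat cmod_ofreal ger0_norm.
rewrite -E; apply: (le_trans (cmod_sum _ _ _)).
have -> : n%:R * (B + e) = \sum_(j < n) (B + e) by rewrite sumr_const card_ord mulr_natl.
apply: ler_sum => j _.
by rewrite cmodM !cmodX cmodV cmodX cw expr1n invr1 expr1n mul1r hP.
Qed.

(** Cauchy's estimate with bound 0, on a circle inside both disks, kills every coefficient of the
    difference. *)
Lemma psum_uniq c c' r M M' s : 0 < r -> pbnd c r M -> pbnd c' r M' -> 0 < s ->
  (forall h, cmod h < s -> psum c h = psum c' h) -> c =1 c'.
Proof.
move=> r0 cM cM' s0 hs k; pose q := Num.min r s / 2.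
have m0 : 0 < Num.min r s by rewrite lt_min r0 s0.
have q0 : 0 < q by rewrite divr_gt0.
have qm : q < Num.min r s by rewrite /q; lra.
have [qr qs] : q < r /\ q < s by move: qm; rewrite lt_min => /andP[].
have sd z : cmod z = q ->
    asum (fun n => c n * z ^+ n) /\ asum (fun n => -1 * (c' n * z ^+ n)).
  move=> zq; split; [|apply: asumZ];
  [apply: pbnd_asum cM _|apply: pbnd_asum cM' _]; rewrite ?zq//.
have E z : (fun n => (c n - c' n) * z ^+ n) =
    (fun n => c n * z ^+ n + -1 * (c' n * z ^+ n)).
  by apply/funext => n; ring.
have hq : cmod (ofreal q) = q by rewrite cmod_ofreal gtr0_norm.
have := @cauchy_estimate (fun n => c n - c' n) q 0 k (ltW q0).
rewrite E => /(_ (asumD (sd _ hq).1 (sd _ hq).2)).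
have H z : cmod z = q -> cmod (psum (fun n => c n - c' n) z) <= 0.
  move=> zq; rewrite /psum E csumD; [|exact: (sd _ zq).1|exact: (sd _ zq).2].
  rewrite csumZ ?mulN1r -/(psum c z) -/(psum c' z); first by rewrite hs ?zq// subrr cmod0.
  by apply: pbnd_asum cM' _; rewrite ?zq.
move=> /(_ H); rewrite pmulr_lle0 ?exprn_gt0// => d0.
by apply/eqP; rewrite -subr_eq0 -cmod_eq0 eq_le d0 cmod_ge0.
Qed.

Lemma sum_delay_le (f : nat -> R) m n : (forall i, 0 <= f i) ->
  \sum_(i < n) (if (m <= i)%N then f (i - m)%N else 0) <= \sum_(i < n) f i.
Proof.
move=> f0; case: (leqP n m) => [nm|/ltnW mn].
  rewrite big1 ?sumr_ge0// => i _; rewrite leqNgt (leq_trans (ltn_ord i) nm)//.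
rewrite -(subnK mn) [X in _ <= X]big_split_ord /= addnC big_split_ord /= big1 => [|i _].
  rewrite add0r; apply: ler_wpDr; first by apply: sumr_ge0 => i _.
  by apply: ler_sum => i _; rewrite leq_addr addKn.
by rewrite leqNgt ltn_ord.
Qed.

Section CauchyProduct.
Variables (c c' : nat -> C) (r M M' : R) (z : C).
Hypotheses (r0 : 0 < r) (cM : pbnd c r M) (cM' : pbnd c' r M') (zr : cmod z < r).

(** Row m is c_m z^m times the second series, delayed by m places; column n then collects the terms
    of total degree n. *)
Let w (m n : nat) : C := if (m <= n)%N then c m * c' (n - m)%N * z ^+ n else 0.

Let asum2_w : exists B, asum2_le w B.
Proof.
have [A hA] := pbnd_asum r0 cM zr; have [A' hA'] := pbnd_asum r0 cM' zr.
exists (A * A') => m n.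
have A'0 : 0 <= A' by have := hA' 0%N; rewrite big_ord0.
apply: (@le_trans _ _ (\sum_(i < m) cmod (c i * z ^+ i) * A')); last first.
  by rewrite -mulr_suml ler_wpM2r.
apply: ler_sum => i _.
apply: (@le_trans _ _ (cmod (c i * z ^+ i) *
   \sum_(j < n) (if (i <= j)%N then cmod (c' (j - i)%N * z ^+ (j - i)) else 0))).
  rewrite mulr_sumr; apply: ler_sum => j _; rewrite /w; case: ifP => ij; last first.
    by rewrite mulr0 cmod0.
  rewrite -cmodM -{2}(subnKC ij) exprD.
  by rewrite le_eqVlt; apply/orP; left; apply/eqP; congr cmod; ring.
apply: ler_wpM2l; first exact: cmod_ge0.
apply: le_trans (hA' n).
by apply: (sum_delay_le (f := fun j => cmod (c' j * z ^+ j))) => j; exact: cmod_ge0.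
Qed.

Let col n : csum (fun m => w m n) = conv c c' n * z ^+ n.
Proof.
rewrite (@csum_finite _ _ n.+1) => [|i ni]; last by rewrite /w leqNgt ni.
rewrite mulr_suml; apply: eq_bigr => i _.
by rewrite /w -ltnS ltn_ord.
Qed.

Lemma psum_conv : psum c z * psum c' z = psum (conv c c') z.
Proof.
have [B wB] := asum2_w.
transitivity (csum (fun m => csum (w m))); last first.
  by rewrite (csum_exchange wB); apply: eq_csum => n; rewrite col.
rewrite mulrC -csumZ; last exact: pbnd_asum cM zr.
apply: eq_csum => m.
rewrite (csum_split m); last by exists B; exact: asum2_row wB.
rewrite big1 ?add0r => [|i _]; last by rewrite /w leqNgt ltn_ord.
rewrite mulrC -csumZ; last exact: pbnd_asum cM' zr.
by apply: eq_csum => i; rewrite /w leq_addr addKn exprD; ring.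
Qed.

Lemma conv_pbnd : exists B, pbnd (conv c c') (cmod z) B.
Proof.
have [B wB] := asum2_w; exists B => n.
have := asum2_csum (asum2_tr wB) n.+1.
rewrite big_ord_recr /= col cmodM cmodX; apply: le_trans.
by rewrite lerDr; apply: sumr_ge0 => i _; exact: cmod_ge0.
Qed.

End CauchyProduct.

Definition has_expansion (f : C -> C) p := exists c r M,
  [/\ 0 < r, pbnd c r M & forall z, cmod (z - p) < r -> f z = psum c (z - p)].

(** Abel's lemma: convergence at one point at distance e / 2 bounds the partial sums, hence the
    terms as their differences. *)
Lemma analytic1_expansion (f : C -> C) p : analytic1_at f p -> has_expansion f p.
Proof.
move=> [c /near_cplxP[e e0 he]].
have he2 : 0 < e / 2 by rewrite divr_gt0.
pose z0 : C := p + ofreal (e / 2).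
have z0p : z0 - p = ofreal (e / 2) by rewrite /z0 addrC addKr.
have [B hB] : exists B, forall n, cmod (\sum_(i < n) c i * (z0 - p) ^+ i - f z0) <= B.
  have /cvg_cplxP cv : series (fun n => c n * (z0 - p) ^+ n) @ \oo --> f z0.
    by apply: he; rewrite z0p cmod_ofreal gtr0_norm//; lra.
  have /cvg_seq_bounded/pinfty_ex_gt0[B _ hB] :
      cvgn (fun n => cmod (series (fun n => c n * (z0 - p) ^+ n) n - f z0)).
    by apply/cvg_ex; exists 0.
  exists B => n; have := hB n I => /=; rewrite ger0_norm ?cmod_ge0//.
  by rewrite seriesEord.
exists c, (e / 2), (B + B); split=> //.
  move=> n; rewrite -[X in _ * X ^+ n](@gtr0_norm _ (e / 2))// -cmod_ofreal -z0p.
  rewrite -cmodX -cmodM.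
  have -> : c n * (z0 - p) ^+ n =
      (\sum_(i < n.+1) c i * (z0 - p) ^+ i - f z0) - (\sum_(i < n) c i * (z0 - p) ^+ i - f z0).
    by rewrite big_ord_recr /=; ring.
  by apply: (le_trans (cmodB _ _)); exact: lerD.
move=> z zp; apply/esym/csum_unique.
have /cvg_cplxP : series (fun n => c n * (z - p) ^+ n) @ \oo --> f z.
  by apply: he; apply: (lt_trans zp); lra.
by rewrite seriesEord.
Qed.

End UnivariateSeries.

(** * Continuation past a closed disk, and Pringsheim's theorem *)

Section Continuation.
Variable R : realType.
Local Notation C := (cplx R).
Implicit Types (f : C -> C) (c : nat -> C) (z p h : C) (r s M B e K : R).

(** One constant controls both size and range: radius of convergence at least 1 / K, agreement with
    f up to distance 1 / (2 K). Monotonicity in K makes it fit for a compactness argument. *)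
Definition expansion_le f p K := exists c,
  (forall n, cmod (c n) <= K * K ^+ n) /\
  (forall z, cmod (z - p) * K <= 1 / 2 -> f z = psum c (z - p)).

Lemma geo_pbnd c K : 0 < K -> (forall n, cmod (c n) <= K * K ^+ n) -> pbnd c K^-1 K.
Proof. by move=> K0 h n; rewrite exprVn ler_pdivrMr ?exprn_gt0. Qed.

Lemma expansion_le_mono f p K K' : 0 < K -> K <= K' ->
  expansion_le f p K -> expansion_le f p K'.
Proof.
move=> K0 KK' [c [hc hf]]; exists c; split.
  move=> n; apply: le_trans (hc n) _; apply: ler_pM => //;
    [exact: ltW|exact/exprn_ge0/ltW|].
  by rewrite lerXn2r// nnegrE ltW// (lt_le_trans K0).
move=> z hz; apply: hf; apply: le_trans hz.
by apply: ler_wpM2l => //; exact: cmod_ge0.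
Qed.

Lemma expansion_near f p : has_expansion f p ->
  exists K d, [/\ 0 < K, 0 < d & forall q, cmod (q - p) < d -> expansion_le f q K].
Proof.
move=> [c [r [M [r0 cM hf]]]].
have M0 := pbnd_ge0 (ltW r0) cM.
have r8 : 0 < 8 / r by rewrite divr_gt0.
(* Within r / 4 of p, the Taylor coefficients are at most 2 M (4 / r)^n. The summand 8 / r dominates
   4 / r and keeps the disk of radius 1 / (2 K) where f equals its series. *)
have K0 : 0 < 2 * M + 8 / r by rewrite ltr_wpDl ?mulr_ge0.
exists (2 * M + 8 / r), (r / 4); split; rewrite ?divr_gt0// => q qp.
have r4 : 0 <= r / 4 by rewrite divr_ge0 ?ltW.
have qr : cmod (q - p) + r / 4 < r by lra.
exists (taylor c (q - p)); split.
  move=> n; have := taylor_pbnd r0 cM r4 qr n.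
  have r4n : 0 < (r / 4) ^+ n by rewrite exprn_gt0 ?divr_gt0.
  rewrite -ler_pdivlMr// => /le_trans; apply.
  apply: ler_pM; rewrite ?invr_ge0 ?exprn_ge0//.
  - have t1 : (cmod (q - p) + r / 4) / r < 1 by rewrite ltr_pdivrMr// mul1r.
    by rewrite mulr_ge0 ?invr_ge0// subr_ge0 ltW.
  - apply: (@le_trans _ _ (2 * M)); last by rewrite lerDl ltW.
    rewrite mulrC; apply: ler_wpM2r => //.
    have t1 : (cmod (q - p) + r / 4) / r <= 1 / 2 by rewrite ler_pdivrMr//; lra.
    by rewrite invf_ple ?posrE//; lra.
  - rewrite -exprVn lerXn2r ?nnegrE ?invr_ge0 ?(ltW K0)//.
    have : 4 / r <= 8 / r by rewrite ler_pM2r ?invr_gt0// ler_nat.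
    by rewrite invf_div; move: M0; lra.
move=> z hz; rewrite -(taylor_psum r0 cM).
  have hz' : cmod (z - q) < r / 2.
    have : cmod (z - q) * (8 / r) <= 1 / 2.
      apply: le_trans hz; apply: ler_wpM2l; first exact: cmod_ge0.
      by rewrite lerDr mulr_ge0.
    rewrite mulrA ler_pdivrMr//; lra.
  have -> : q - p + (z - q) = z - p by ring.
  apply: hf; apply: le_lt_trans (cmod_dist3 q _ _) _; lra.
have hz' : cmod (z - q) * (8 / r) <= 1 / 2.
  apply: le_trans hz; apply: ler_wpM2l; first exact: cmod_ge0.
  by rewrite lerDr mulr_ge0.
move: hz'; rewrite mulrA ler_pdivrMr//; lra.
Qed.

(** Compactness in covering form, with K tending to infinity as the filter. It is applied to the
    real square around the disk; a point outside the disk has a neighbourhood where the claim is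
    vacuous. *)
Lemma disk_expansion_le f X : (forall p, cmod p <= X -> has_expansion f p) ->
  exists2 K, 0 < K & forall p, cmod p <= X -> expansion_le f p K.
Proof.
move=> hf.
pose emb (x : R * R) : C := Complex x.1 x.2.
have embB x y : cmod (emb x - emb y) <= `|x.1 - y.1| + `|x.2 - y.2|.
  by apply: le_trans (cmod_le_ReIm _) _; rewrite ReB ImB.
have cpt : compact (`[- X, X]%classic `*` `[- X, X]%classic : set (R * R)).
  by apply: compact_setX; exact: segment_compact.
move/compact_near_coveringP: cpt.
move=> /(_ R (pinfty_nbhs R) (fun K x => cmod (emb x) <= X -> expansion_le f (emb x) K)).
case=> [|M [_ hM]].
  move=> x _; have [xX|Xx] := leP (cmod (emb x)) X.
    have [K [d [K0 d0 hK]]] := expansion_near (hf _ xX).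
    exists (ball x (d / 2), [set K' | K < K']).
      split; first by apply: nbhsx_ballx; rewrite divr_gt0.
      by exists K; split; [exact: num_real|].
    move=> [y K'] /= [[y1 y2] KK'] _.
    apply: (expansion_le_mono K0 (ltW KK')); apply: hK.
    apply: le_lt_trans (embB _ _) _; rewrite [d]splitr distrC [X in _ + X]distrC.
    exact: ltrD.
  have d0 : 0 < cmod (emb x) - X by rewrite subr_gt0.
  exists (ball x ((cmod (emb x) - X) / 2), setT).
    split; first by apply: nbhsx_ballx; rewrite divr_gt0.
    by exists 0; split; [exact: num_real|].
  move=> [y K'] /= [[y1 y2] _] yX; exfalso.
  have := embB x y; have := cmodB_ge (emb x) (emb y).
  rewrite /ball /= in y1 y2; move: y1 y2 yX => /=; lra.
pose K := Num.max M 0 + 1.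
have K0 : 0 < K by rewrite ltr_wpDl// le_max lexx orbT.
exists K => // p pX.
have MK : M < K by rewrite /K ltr_pwDr// le_max lexx.
have := hM _ MK (complex.Re p, complex.Im p).
have -> : emb (complex.Re p, complex.Im p) = p by rewrite /emb; case: (p).
apply=> //; split=> /=; rewrite in_itv /= -ler_norml.
  exact: le_trans (Re_le_cmod _) pX.
exact: le_trans (Im_le_cmod _) pX.
Qed.

(** How bounds on derivatives at p enlarge a radius: expanding (p + 1 / (2 Q))^m, the n-th term is
    at most A / 2^n. *)
Lemma binom_growth (b : nat -> R) (p A Q : R) m : 0 <= p -> 0 <= A -> 0 < Q ->
  (forall n, (n <= m)%N -> 'C(m, n)%:R * b m * p ^+ (m - n) <= A * Q ^+ n) ->
  b m * (p + 1 / (2 * Q)) ^+ m <= 2 * A.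
Proof.
move=> p0 A0 Q0 h; rewrite exprDn mulr_sumr.
apply: (@le_trans _ _ (\sum_(i < m.+1) A * (1 / 2) ^+ i)); last first.
  rewrite -mulr_sumr mulrC; apply: ler_wpM2r => //.
  apply: le_trans (geo_sum_le _ _) _; first by apply/andP; split; lra.
  by rewrite invf_ple ?posrE//; lra.
apply: ler_sum => i _.
have -> : b m * (p ^+ (m - i) * (1 / (2 * Q)) ^+ i *+ 'C(m, i)) =
   'C(m, i)%:R * b m * p ^+ (m - i) * (1 / (2 * Q)) ^+ i.
  by rewrite -mulr_natl; ring.
have -> : A * (1 / 2) ^+ i = A * Q ^+ i * (1 / (2 * Q)) ^+ i.
  rewrite -mulrA -exprMn; congr (_ * _ ^+ _); field; exact: lt0r_neq0.
apply: ler_wpM2r; first by rewrite exprn_ge0// divr_ge0// mulr_ge0// ltW.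
by apply: h; rewrite -ltnS.
Qed.

(** By uniqueness the unnamed local coefficients are those of the re-expanded global series, which
    therefore inherits the bound by K. *)
Lemma expansion_taylor f (e : nat -> C) r M z K : 0 < r -> 0 < K -> pbnd e r M -> cmod z < r ->
  (forall y, cmod y < r -> f y = psum e y) -> expansion_le f z K ->
  (forall n, cmod (taylor e z n) <= K * K ^+ n) /\
  (forall y, cmod (y - z) * K <= 1 / 2 -> f y = psum (taylor e z) (y - z)).
Proof.
move=> r0 K0 eM zr hf [c [hc hfc]].
suff /funext -> : taylor e z =1 c by [].
pose s := (r - cmod z) / 2.
have s0 : 0 < s by rewrite divr_gt0// subr_gt0.
have zs : cmod z + s < r by rewrite /s; lra.
have tM := taylor_pbnd r0 eM (ltW s0) zs.
have cM := geo_pbnd K0 hc.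
pose t := Num.min s (K^-1).
have t0 : 0 < t by rewrite lt_min s0 invr_gt0.
have ts : t <= s by rewrite ge_min lexx.
have tK : t <= K^-1 by rewrite ge_min lexx orbT.
have st : 0 <= t <= s by rewrite ltW.
have tK' : 0 <= t <= K^-1 by rewrite ltW.
apply: (psum_uniq t0 (pbnd_sub st tM) (pbnd_sub tK' cM) (s := t / 2)).
  by rewrite divr_gt0.
move=> h ht.
have zh : cmod z + cmod h < r by lra.
rewrite -(taylor_psum r0 eM zh).
have -> : psum c h = psum c (z + h - z) by congr psum; ring.
rewrite -hfc ?hf//; first by apply: le_lt_trans zh; exact: cmodD.
rewrite (addrC z) addrK -ler_pdivlMr//; lra.
Qed.

(** Taylor coefficients on a circle just inside radius r are at most K K^n. Cauchy's estimate on
    that circle, applied to the n-th derivative, isolates each e_m, and [binom_growth] gives the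
    larger radius. The gain 1 / (4 K) does not depend on r. *)
Lemma continuation_step f (e : nat -> C) (X K r : R) : 0 < K -> 0 < r -> r <= X ->
  (forall p, cmod p <= X -> expansion_le f p K) ->
  (exists M, pbnd e r M) -> (forall z, cmod z < r -> f z = psum e z) ->
  (exists M, pbnd e (r + 1 / (4 * K)) M) /\
  (forall z, cmod z < r + 1 / (4 * K) -> f z = psum e z).
Proof.
move=> K0 r0 rX hK [M eM] hf.
set d := 1 / (4 * K).
have d0 : 0 < d by rewrite divr_gt0// mulr_gt0.
have dK : d * K = 1 / 4 by rewrite /d; field; exact: lt0r_neq0.
(* r' is positive, below r, and at most d / 2 below it; so r' + 1 / (2 K) = r' + 2 d still exceeds r
   + d. *)
pose r' := Num.max (r - d / 2) (r / 2).
have [r'0 r'r r'd] : [/\ 0 < r', r' < r & r - d / 2 <= r'].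
  split; first by rewrite lt_max; apply/orP; right; lra.
    by rewrite gt_max; apply/andP; split; lra.
  by rewrite le_max lexx.
have T z : cmod z = r' -> _ := fun zr =>
  expansion_taylor r0 K0 eM (eq_ind_r (fun t => t < r) r'r zr) hf
    (hK z (eq_ind_r (fun t => t <= X) (le_trans (ltW r'r) rX) zr)).
have eB : pbnd e (r + d) (2 * K).
  apply: (@pbnd_sub _ _ (r' + 1 / (2 * K))).
    rewrite addr_ge0 ?ltW//=.
    have -> : 1 / (2 * K) = 2 * d by rewrite /d; field; exact: lt0r_neq0.
    by lra.
  move=> m; apply: (@binom_growth (fun m => cmod (e m)) _ _ K) => // [||n nm]; [exact: ltW|exact: ltW|].
  have E z k : 'C(n + k, n)%:R * e (n + k)%N * z ^+ (n + k - n) =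
      'C(n + k, n)%:R * e (n + k)%N * z ^+ k by rewrite addKn.
  have cr' : cmod (ofreal r') = r' by rewrite cmod_ofreal gtr0_norm.
  have := @cauchy_estimate R (fun k => 'C(n + k, n)%:R * e (n + k)%N) r' (K * K ^+ n) (m - n) (ltW r'0).
  rewrite subnKC// cmodM cmod_nat; apply.
    have := @asum_shift _ _ n (@taylor_asum _ e r M (ofreal r') n r0 eM (eq_ind_r (fun t => t < r) r'r cr')).
    by under eq_fun do rewrite E.
  move=> z zr; have [tz _] := T z zr; apply: le_trans (tz n).
  have zr1 : cmod z < r by rewrite zr.
  rewrite /taylor (csum_split n (taylor_asum n r0 eM zr1)) big1 ?add0r => [|i _].
    by rewrite /psum; under [X in _ <= cmod (csum X)]eq_fun do rewrite E.
  by rewrite bin_small ?mul0r.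
split; first by exists (2 * K).
move=> z zrd; have [zr|rz] := ltP (cmod z) r; first exact: hf.
have z0 : 0 < cmod z by apply: lt_le_trans rz.
pose p := z * ofreal (r' / cmod z).
have rz1 : r' / cmod z <= 1 by rewrite ler_pdivrMr// mul1r (le_trans (ltW r'r)).
have pr' : cmod p = r'.
  rewrite cmodM cmod_ofreal ger0_norm ?divr_ge0 ?ltW//.
  by rewrite mulrC divfK// gt_eqF.
have zp : cmod (z - p) = cmod z - r'.
  have -> : z - p = z * ofreal (1 - r' / cmod z) by rewrite rmorphB rmorph1 /p; ring.
  rewrite cmodM cmod_ofreal ger0_norm ?subr_ge0// mulrBr mulr1.
  by rewrite mulrCA divff ?mulr1// gt_eqF.
have [_ ->] := T p pr'; last first.
  rewrite zp; apply: (@le_trans _ _ (3 / 2 * d * K)); last by rewrite -mulrA dK; lra.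
  by apply: ler_wpM2r; [exact: ltW|lra].
rewrite -(taylor_psum (addr_gt0 r0 d0) eB) ?(addrC p) ?subrK//.
by rewrite pr' zp addrC subrK.
Qed.

(** A step is allowed from any radius up to X, and its length is fixed, so finitely many steps lead
    strictly beyond X. *)
Lemma disk_continuation f (e : nat -> C) (X r0 M : R) : 0 < r0 -> pbnd e r0 M ->
  (forall z, cmod z < r0 -> f z = psum e z) ->
  (forall p, cmod p <= X -> has_expansion f p) ->
  exists r M', [/\ X < r, pbnd e r M' & forall z, cmod z < r -> f z = psum e z].
Proof.
move=> r00 eM hf hX; have [K K0 hK] := disk_expansion_le hX.
pose d := 1 / (4 * K).
have d0 : 0 < d by rewrite divr_gt0// mulr_gt0.
pose P r := (exists M, pbnd e r M) /\ (forall z, cmod z < r -> f z = psum e z).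
have step n : P (r0 + d *+ n) \/ exists2 r, X < r & P r.
  elim: n => [|n [Pn|?]]; last by right.
    by left; rewrite mulr0n addr0; split; [exists M|].
  have [rX|Xr] := leP (r0 + d *+ n) X; last by right; exists (r0 + d *+ n).
  left; rewrite mulrSr addrA; case: Pn => P1 P2.
  by apply: continuation_step K0 _ rX hK P1 P2; rewrite ltr_wpDr// mulrn_wge0// ltW.
have [n hn] : exists n, X < r0 + d *+ n.
  exists (Num.truncn (`|X| / d)).+1.
  have : `|X| / d < (Num.truncn (`|X| / d)).+1%:R by rewrite truncnS_gt// divr_ge0// ltW.
  rewrite ltr_pdivrMr// mulr_natl => h; apply: le_lt_trans (ler_norm X) _.
  by rewrite ltr_wpDl// ltW.
have [[[M' h1] h2]|[r Xr [[M' h1] h2]]] := step n.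
  by exists (r0 + d *+ n), M'.
by exists r, M'.
Qed.

(** Strong induction on the recursion for the coefficients of u / v. With A = 2 K / c0, the ratio Q
    is chosen so that Q - K = A K, which makes the convolution of the majorants telescope. *)
Lemma conv_quotient_le (c u v : nat -> C) K (c0 : R) : 0 < K -> 0 < c0 ->
  (forall n, cmod (u n) <= K * K ^+ n) -> (forall n, cmod (v n) <= K * K ^+ n) ->
  c0 <= cmod (v 0%N) -> conv c v =1 u ->
  forall n, cmod (c n) <= 2 * K / c0 * (K + 2 * K ^+ 2 / c0) ^+ n.
Proof.
move=> K0 c00 hu hv hc0 cv; set A := 2 * K / c0; set Q := K + _.
have A0 : 0 <= A by rewrite divr_ge0 ?mulr_ge0 ?ltW.
have QK : Q - K = A * K by rewrite /Q /A; ring.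
have S n : A * \sum_(i < n) Q ^+ i * K ^+ (n - i) = Q ^+ n - K ^+ n.
  elim: n => [|n IH]; first by rewrite big_ord0 mulr0 !expr0 subrr.
  rewrite big_ord_recr /= subSnn expr1 mulrDr.
  have -> : \sum_(i < n) Q ^+ i * K ^+ (n.+1 - i) = K * \sum_(i < n) Q ^+ i * K ^+ (n - i).
    rewrite mulr_sumr; apply: eq_bigr => i _.
    by rewrite subSn 1?ltnW// exprS; ring.
  rewrite mulrCA IH mulrCA -QK !exprS; ring.
have Q0 : 0 < Q by rewrite ltr_pwDl// divr_ge0 ?mulr_ge0 ?exprn_ge0 ?ltW.
elim/ltn_ind => n IH.
have E : c n * v 0%N = u n - \sum_(i < n) c i * v (n - i)%N.
  by rewrite -cv /conv big_ord_recr /= subnn addrAC subrr add0r.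
have : cmod (c n) * c0 <= K * Q ^+ n.
  apply: le_trans (ler_wpM2l (cmod_ge0 _) hc0) _.
  rewrite -cmodM E; apply: le_trans (cmodB _ _) _.
  apply: (@le_trans _ _ (K * K ^+ n + K * (A * \sum_(i < n) Q ^+ i * K ^+ (n - i)))); last first.
    by rewrite S mulrBr addrC subrK.
  apply: lerD; first exact: hu.
  rewrite !mulr_sumr; apply: le_trans (cmod_sum _ _ _) _; apply: ler_sum => i _.
  rewrite cmodM.
  have -> : K * (A * (Q ^+ i * K ^+ (n - i))) = A * Q ^+ i * (K * K ^+ (n - i)) by ring.
  by apply: ler_pM; rewrite ?cmod_ge0 ?IH.
rewrite -ler_pdivlMr// => /le_trans; apply.
have -> : A * Q ^+ n = 2 * (K * Q ^+ n / c0) by rewrite /A; ring.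
by rewrite ler_peMl ?divr_ge0 ?mulr_ge0 ?exprn_ge0 ?ltW// ltr1n.
Qed.

Lemma nonneg_term_le_csum (t : nat -> R) m : (forall i, 0 <= t i) ->
  asum (fun i => ofreal (t i)) -> t m <= cmod (csum (fun i => ofreal (t i))).
Proof.
move=> t0 st; apply/ler_addgt0Pr => e e0.
have [N hN] := csum_near st e0.
have := hN _ (leq_maxl N m.+1); set n := maxn _ _ => h.
have mn : (m < n)%N by rewrite leq_max leqnn orbT.
apply: (@le_trans _ _ (cmod (\sum_(i < n) ofreal (t i)))).
  rewrite -rmorph_sum cmod_ofreal ger0_norm ?sumr_ge0//.
  by rewrite (bigD1 (Ordinal mn))//= lerDl sumr_ge0.
rewrite -lerBlDl; apply: le_trans (cmodB_ge _ _) (ltW h).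
Qed.

Lemma has_expansion_at f p c r M : 0 < r -> pbnd c r M ->
  (forall z, cmod (z - p) < r -> f z = psum c (z - p)) -> f p = c 0%N.
Proof.
move=> r0 cM hf; rewrite hf ?subrr ?cmod0//; apply/eqP; rewrite -subr_eq0 -cmod_eq0.
rewrite eq_le cmod_ge0 andbT; apply: le_trans (psum_lip r0 cM _) _.
  by rewrite cmod0 divr_ge0 ?ltW.
by rewrite cmod0 mulr0.
Qed.

Lemma has_expansion_lip f p : has_expansion f p ->
  exists L d, [/\ 0 <= L, 0 < d & forall z, cmod (z - p) <= d -> cmod (f z - f p) <= L * cmod (z - p)].
Proof.
move=> [c [r [M [r0 cM hf]]]]; exists (2 * M / r), (r / 2); split.
- by rewrite divr_ge0 ?mulr_ge0 ?(pbnd_ge0 (ltW r0) cM)// ltW.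
- by rewrite divr_gt0.
move=> z zp; rewrite (has_expansion_at r0 cM hf) hf; first exact: psum_lip.
by apply: le_lt_trans zp _; lra.
Qed.

(* Pringsheim: the Taylor coefficients of the quotient u / v are bounded geometrically,
   uniformly at the points left of rho, and the Taylor coefficients of b there are sums
   of nonnegative terms. *)
Lemma pringsheim (b : nat -> R) (u v : C -> C) (rho d : R) :
  (forall n, 0 <= b n) -> 0 < rho -> 0 < d ->
  (forall r, 0 < r < rho -> exists M, pbnd (fun n => ofreal (b n)) r M) ->
  has_expansion u (ofreal rho) -> has_expansion v (ofreal rho) -> v (ofreal rho) != 0 ->
  (forall z, cmod (z - ofreal rho) < d -> cmod z < rho ->
     psum (fun n => ofreal (b n)) z * v z = u z) ->
  exists r M, rho < r /\ pbnd (fun n => ofreal (b n)) r M.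
Proof.
move=> b0 rho0 d0 hb hu hv v0 huv.
have [Ku [du [Ku0 du0 hKu]]] := expansion_near hu.
have [Kv [dv [Kv0 dv0 hKv]]] := expansion_near hv.
have [L [dl [L0 dl0 hL]]] := has_expansion_lip hv.
pose K := Num.max Ku Kv.
have K0 : 0 < K by rewrite lt_max Ku0.
pose c0 := cmod (v (ofreal rho)) / 2.
have c00 : 0 < c0 by rewrite divr_gt0// cmod_gt0.
pose A := 2 * K / c0; pose Q := K + 2 * K ^+ 2 / c0.
have A0 : 0 <= A by exact: divr_ge0 (mulr_ge0 (ler0n _ 2) (ltW K0)) (ltW c00).
have Q0 : 0 < Q 
  by apply: ltr_pwDl => //; exact: divr_ge0 (mulr_ge0 (ler0n _ 2) (exprn_ge0 _ (ltW K0))) (ltW c00).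
(* d1 keeps q = rho - t where the expansions, the Lipschitz bound and the identity hold. In d2, the
   bound 1 / (2 Q) puts the new radius rho - t + 1 / (2 Q) beyond rho, and c0 / (L + 1) keeps |v q|
   at least c0. *)
pose d1 := Num.min (Num.min du dv) (Num.min dl d).
pose d2 := Num.min (Num.min rho (1 / (2 * Q))) (c0 / (L + 1)).
pose t := Num.min d1 d2 / 2.
have L1 : 0 < L + 1 by rewrite ltr_wpDl.
have m0 : 0 < Num.min d1 d2.
  rewrite !lt_min du0 dv0 dl0 d0 rho0 /=; apply/andP; split.
    by apply: divr_gt0 => //; exact: mulr_gt0.
  exact: divr_gt0.
have [mdu mdv mdl md] : [/\ Num.min d1 d2 <= du, Num.min d1 d2 <= dv,
    Num.min d1 d2 <= dl & Num.min d1 d2 <= d].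
  by split; rewrite !ge_min lexx ?orbT.
have [mrho mQ mL] : [/\ Num.min d1 d2 <= rho, Num.min d1 d2 <= 1 / (2 * Q)
    & Num.min d1 d2 <= c0 / (L + 1)].
  by split; rewrite !ge_min lexx ?orbT.
have t0 : 0 < t by rewrite /t divr_gt0.
have tm : t + t = Num.min d1 d2 by rewrite /t -splitr.
set q := ofreal (rho - t).
have qrho : q - ofreal rho = ofreal (- t) by rewrite /q -rmorphB; congr ofreal; ring.
have dq : cmod (q - ofreal rho) = t by rewrite qrho cmod_ofreal normrN gtr0_norm.
have cq : cmod q = rho - t by rewrite cmod_ofreal gtr0_norm//; lra.
have [U [hU hfU]] : expansion_le u q K.
  by apply: (expansion_le_mono Ku0); [rewrite le_max lexx|apply: hKu; rewrite dq; lra].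
have [V [hV hfV]] : expansion_le v q K.
  by apply: (expansion_le_mono Kv0); [rewrite le_max lexx orbT|apply: hKv; rewrite dq; lra].
have iK : 1 / (2 * K) = K^-1 / 2 by field; exact: lt0r_neq0.
have iK0 : 0 < K^-1 by rewrite invr_gt0.
have PU := geo_pbnd K0 hU; have PV := geo_pbnd K0 hV.
have hV0 : c0 <= cmod (V 0%N).
  have -> : V 0%N = v q.
    apply/esym; apply: (@has_expansion_at v q V (1 / (2 * K)) K).
    - by rewrite divr_gt0 ?mulr_gt0.
    - by apply: pbnd_sub PV; rewrite iK; apply/andP; split; lra.
    - move=> z hz; apply: hfV; rewrite -ler_pdivlMr//; apply/ltW; apply: lt_le_trans hz _.
      by rewrite le_eqVlt; apply/orP; left; apply/eqP; field; exact: lt0r_neq0.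
  have := hL q; rewrite dq => /(_ (ltac:(lra))) h.
  have : L * t <= c0.
    apply: (@le_trans _ _ ((L + 1) * (c0 / (L + 1)))).
      by apply: ler_pM; lra.
    by rewrite mulrC divfK// gt_eqF.
  have := cmodB_ge (v (ofreal rho)) (v q); rewrite cmod_distrC /c0 in h *; lra.
pose r1 := rho - t / 2.
have [M bM] : exists M, pbnd (fun n => ofreal (b n)) r1 M.
  by apply: hb; rewrite /r1; apply/andP; split; lra.
have r10 : 0 < r1 by rewrite /r1; lra.
set c := taylor (fun n => ofreal (b n)) q.
have t4 : 0 <= t / 4 by lra.
have qr1 : cmod q + t / 4 < r1 by rewrite cq /r1; lra.
have cM := taylor_pbnd r10 bM t4 qr1.
pose s := Num.min (t / 4) (1 / (2 * K)).
have s0 : 0 < s by rewrite lt_min !divr_gt0 ?mulr_gt0.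
have [st sK] : s <= t / 4 /\ s <= 1 / (2 * K) by rewrite !ge_min !lexx orbT.
have sK' : s <= K^-1.
  by apply: le_trans sK _; rewrite iK; lra.
have cM' := pbnd_sub (ltac:(rewrite (ltW s0) st; done) : 0 <= s <= t / 4) cM.
have PU' := pbnd_sub (ltac:(rewrite (ltW s0) sK'; done) : 0 <= s <= K^-1) PU.
have PV' := pbnd_sub (ltac:(rewrite (ltW s0) sK'; done) : 0 <= s <= K^-1) PV.
have cUV : conv c V =1 U.
  have s2 : cmod (ofreal (s / 2)) = s / 2 by rewrite cmod_ofreal gtr0_norm// divr_gt0.
  have [B hB] := conv_pbnd s0 cM' PV' (ltac:(rewrite s2; lra) : cmod (ofreal (s / 2)) < s).
  rewrite s2 in hB.
  have PU2 := pbnd_sub (ltac:(apply/andP; split; lra) : 0 <= s / 2 <= s) PU'.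
  apply: (psum_uniq _ hB PU2 (s := s / 2)); rewrite ?divr_gt0// => h hs.
  have hs' : cmod h < s by lra.
  rewrite -(psum_conv s0 cM' PV' hs') /c -(taylor_psum r10 bM); last by rewrite cq /r1; lra.
  have hK : cmod (q + h - q) * K <= 1 / 2.
    rewrite (addrC q) addrK -ler_pdivlMr//; apply: le_trans (ltW hs') _; apply: le_trans sK _.
    by rewrite le_eqVlt; apply/orP; left; apply/eqP; field; exact: lt0r_neq0.
  have EV := hfV _ hK; have EU := hfU _ hK; 
  have qh : q + h - q = h by ring.
  rewrite qh in EV EU.
  rewrite -EV -EU; apply: huv.
    have -> : q + h - ofreal rho = (q - ofreal rho) + h by ring.
    by apply: le_lt_trans (cmodD _ _) _; rewrite dq; lra.
  by apply: le_lt_trans (cmodD _ _) _; rewrite cq; lra.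
have hc := conv_quotient_le K0 c00 hU hV hV0 cUV.
exists (rho - t + 1 / (2 * Q)), (2 * A); split.
  by lra.
move=> m; rewrite cmod_ofreal ger0_norm//.
apply: binom_growth => // [|n nm]; first by lra.
apply: le_trans (hc n).
have E : (fun m => 'C(m, n)%:R * ofreal (b m) * q ^+ (m - n)) =
    (fun m => ofreal ('C(m, n)%:R * b m * (rho - t) ^+ (m - n))).
  by apply/funext => k; rewrite !rmorphM /= rmorph_nat rmorphXn.
rewrite /c /taylor E; apply: (nonneg_term_le_csum (t := fun m => 'C(m, n)%:R * b m * (rho - t) ^+ (m - n))).
  by move=> i; rewrite !mulr_ge0 ?exprn_ge0//; lra.
rewrite -E; apply: (taylor_asum n r10 bM); rewrite cq /r1; lra.
Qed.

End Continuation.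

(** * Power series in several variables, restricted to lines *)

Section SeveralVariables.
Variables (R : realType) (d : nat).
Local Notation C := (cplx R).
Implicit Types (c : multiindex d -> C) (z v p : 'rV[C]_d) (H : 'rV[C]_d -> C).
Implicit Types (a : multiindex d -> R) (w : 'I_d -> R).

Definition shl k : seq (multiindex d) := enum_fset (fset_set (@shell d k)).

Lemma mem_shl k s : (s \in shl k) = (mdeg s == k).
Proof.
rewrite -[_ \in _]/(s \in fset_set (@shell d k)) in_fset_set; last exact: finite_shell.
by apply/idP/eqP => [/set_mem|/mem_set].
Qed.

Lemma shell_sumE (V : nmodType) k (f : multiindex d -> V) :
  \sum_(s \in @shell d k) f s = \sum_(s <- shl k) f s.
Proof. by rewrite fsbig_finite//; exact: finite_shell. Qed.

(** The homogeneous part of degree k; equivalently the k-th coefficient of the series restricted to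
    the line of multiples of v. *)
Definition homog c v k : C := \sum_(s <- shl k) c s * monom v s.

Lemma monomZ (t : C) v s : monom (t *: v) s = t ^+ mdeg s * monom v s.
Proof.
rewrite /monom /mdeg -prodrXr -big_split; apply: eq_bigr => j _.
by rewrite mxE exprMn.
Qed.

Lemma homogZ c (t : C) v k : homog c (t *: v) k = t ^+ k * homog c v k.
Proof.
rewrite /homog mulr_sumr; apply: eq_big_seq => s.
by rewrite mem_shl => /eqP sk; rewrite monomZ sk; ring.
Qed.

Lemma mps_cvg_bound c v : mps_cvg c v ->
  exists B, forall n, \sum_(k < n) \sum_(s <- shl k) cmod (c s * monom v s) <= B.
Proof.
move=> /cvg_ex[l /cvg_cplxP lv].
have /cvg_seq_bounded/pinfty_ex_gt0[B _ hB] : cvgn (fun n => cmod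
    (series (fun k => \sum_(s \in shell k) `|c s * monom v s|) n - l)).
  by apply/cvg_ex; exists 0.
exists (B + cmod l) => n; have := hB n I => /=; rewrite ger0_norm ?cmod_ge0//.
rewrite seriesEord /= => h; rewrite -lerBlDr; apply: le_trans h.
apply: le_trans (cmodB_ge _ _); rewrite lerD2r.
have -> : \sum_(k < n) \sum_(s \in @shell d k) `|c s * monom v s| =
    ofreal (\sum_(k < n) \sum_(s <- shl k) cmod (c s * monom v s)).
  rewrite rmorph_sum; apply: eq_bigr => k _; rewrite shell_sumE rmorph_sum.
  by apply: eq_bigr => s _; rewrite ofreal_cmod.
by rewrite cmod_ofreal ler_norm.
Qed.

Lemma bound_mps_cvg c v B :
  (forall n, \sum_(k < n) \sum_(s <- shl k) cmod (c s * monom v s) <= B) -> mps_cvg c v.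
Proof.
move=> hB; pose t k := \sum_(s <- shl k) cmod (c s * monom v s).
have t0 k : 0 <= t k by apply: sumr_ge0 => s _; exact: cmod_ge0.
have st : asum (fun k => ofreal (t k)).
  exists B => n; apply: le_trans (hB n); apply: ler_sum => k _.
  by rewrite cmod_ofreal ger0_norm.
apply/cvg_ex; exists (csum (fun k => ofreal (t k))); apply/cvg_cplxP.
apply: cvg_trans (asum_csum_cvg st); apply: near_eq_cvg; apply: nearW => n.
apply/esym; rewrite seriesEord /=; congr (cmod (_ - _)).
apply: eq_bigr => k _; rewrite shell_sumE rmorph_sum.
by apply: eq_bigr => s _; rewrite ofreal_cmod.
Qed.

Lemma homog_asum c v : mps_cvg c v -> asum (homog c v).
Proof.
move=> /mps_cvg_bound[B hB]; exists B => n; apply: le_trans (hB n).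
by apply: ler_sum => k _; exact: cmod_sum.
Qed.

Lemma mps_sumE c v : mps_cvg c v -> mps_sum c v = csum (homog c v).
Proof.
move=> cv; suff h : series (fun k => \sum_(s \in @shell d k) (c s * monom v s)) @ \oo -->
    csum (homog c v) by exact: (cvg_lim (@norm_hausdorff _ C) h).
apply/cvg_cplxP.
apply: cvg_trans (asum_csum_cvg (homog_asum cv)); apply: near_eq_cvg; apply: nearW => n.
apply/esym; rewrite seriesEord /=; congr (cmod (_ - _)).
by apply: eq_bigr => k _; rewrite shell_sumE.
Qed.

(** As p lies on the line, the displacement from p is (t - t0) v, and homogeneity turns the
    expansion at p into a series in t - t0. *)
Lemma analytic_ray H p v (t0 : C) : p = t0 *: v -> analytic_at H p ->
  has_expansion (fun t => H (t *: v)) t0.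
Proof.
move=> -> [c /near_row_cplxP[e e0 he]].
pose W := 1 + \sum_j cmod (v 0 j).
have W0 : 0 < W by rewrite /W ltr_pwDl// sumr_ge0// => j _; exact: cmod_ge0.
have vW j : cmod (v 0 j) <= W.
  rewrite /W (bigD1 j)//= addrCA lerDl addr_ge0// sumr_ge0// => i _; exact: cmod_ge0.
pose r := e / (2 * W).
have r0 : 0 < r by rewrite /r divr_gt0// mulr_gt0.
have rW : r * W = e / 2 by rewrite /r; field; exact: lt0r_neq0.
have ht (t : C) : cmod (t - t0) <= r ->
    mps_cvg c ((t - t0) *: v) /\ H (t *: v) = mps_sum c ((t - t0) *: v).
  move=> tr; have := he (t *: v); rewrite -scalerBl; apply => j.
  rewrite !mxE -mulrBl cmodM; apply: (@le_lt_trans _ _ (r * W)); last by rewrite rW; lra.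
  by apply: ler_pM; rewrite ?cmod_ge0.
have [B hB] : exists B, pbnd (homog c v) r B.
  have cr : cmod (ofreal r) = r by rewrite cmod_ofreal gtr0_norm.
  have [] := ht (t0 + ofreal r); first by rewrite addrC addKr cr.
  rewrite addrC addKr => /mps_cvg_bound[B hB] _; exists B => n.
  have := hB n.+1; rewrite big_ord_recr /=; apply: le_trans.
  apply: (@le_trans _ _ (cmod (homog c (ofreal r *: v) n))).
    by rewrite homogZ cmodM cmodX cr mulrC.
  apply: ler_wpDl; last exact: cmod_sum.
  by apply: sumr_ge0 => i _; apply: sumr_ge0 => s _; exact: cmod_ge0.
exists (homog c v), r, B; split=> // t tr.
have [cv ->] := ht t (ltW tr).
rewrite mps_sumE// /psum; apply: eq_csum => k; rewrite homogZ mulrC//.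
Qed.

Lemma monom_deg1 s : mdeg s = 1%N -> exists j, forall v, monom v s = v 0 j.
Proof.
move=> s1.
have [j sj] : exists j, s j != 0%N.
  case: (pickP (fun j => s j != 0%N)) => [j sj|s0]; first by exists j.
  by move: s1; rewrite /mdeg big1// => j _; apply/eqP; move/negbT: (s0 j); rewrite negbK.
exists j => v; move: s1; rewrite /mdeg (bigD1 j)//=.
case sj1 : (s j) sj => [|[|q]]// _ [] /eqP.
rewrite sum_nat_eq0 => /forallP s0.
rewrite /monom (bigD1 j)//= sj1 expr1 big1 ?mulr1// => i ij.
by have := s0 i; rewrite ij /= => /eqP ->; rewrite expr0.
Qed.

Lemma homog1E c v : homog c v 1 = \sum_j v 0 j * homog c (delta_mx 0 j) 1.
Proof.
under [RHS]eq_bigr do rewrite /homog mulr_sumr.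
rewrite exchange_big; apply: eq_big_seq => s; rewrite mem_shl => /eqP /monom_deg1[j hj].
rewrite hj (bigD1 j)//= big1 => [|i ij].
  by rewrite hj mxE !eqxx addr0 mulr1 mulrC.
by rewrite hj mxE eqxx /= eq_sym (negPf ij) !mulr0.
Qed.

Lemma cmod_monom_le v (m : R) s : (forall j, cmod (v 0 j) <= m) ->
  cmod (monom v s) <= m ^+ mdeg s.
Proof.
move=> vm; rewrite /monom cmod_prod /mdeg -prodrXr; apply: ler_prod => j _.
rewrite cmod_ge0 cmodX lerXn2r ?nnegrE ?cmod_ge0//.
exact: le_trans (cmod_ge0 _) (vm j).
Qed.

Lemma analytic_first_order H p : analytic_at H p -> exists (l : 'I_d -> C) L e,
  [/\ 0 <= L, 0 < e & forall v (m : R), (forall j, cmod (v 0 j) <= m) -> 0 <= m <= e ->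
    cmod (H (p + v) - H p - \sum_j v 0 j * l j) <= L * m ^+ 2].
Proof.
move=> [c /near_row_cplxP[e e0 he]].
have hv v : (forall j, cmod (v 0 j) < e) -> mps_cvg c v /\ H (p + v) = mps_sum c v.
  by move=> ve; have := he (p + v); rewrite (addrC p) addrK; apply=> j; rewrite mxE addrK.
have e2 : cmod (ofreal (e / 2)) = e / 2 by rewrite cmod_ofreal gtr0_norm// divr_gt0.
have [B hB] : exists B, forall n,
    \sum_(k < n) \sum_(s <- shl k) cmod (c s) * (e / 2) ^+ k <= B.
  have [] := hv (const_mx (ofreal (e / 2))); first by move=> j; rewrite mxE e2; lra.
  move=> /mps_cvg_bound[B hB] _; exists B => n; apply: le_trans (hB n).
  apply: ler_sum => k _; rewrite le_eqVlt; apply/orP; left; apply/eqP.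
  apply: eq_big_seq => s; rewrite mem_shl => /eqP sk.
  rewrite cmodM; congr (_ * _); rewrite -sk /monom cmod_prod /mdeg -prodrXr.
  by apply: eq_bigr => j _; rewrite mxE cmodX e2.
exists (fun j => homog c (delta_mx 0 j) 1), (4 / e ^+ 2 * B), (e / 4); split.
- apply: mulr_ge0; first by apply: divr_ge0 => //; exact/exprn_ge0/ltW.
  by have := hB 0%N; rewrite big_ord0.
- by rewrite divr_gt0.
move=> v m vm /andP[m0 me].
have [cv Hv] : mps_cvg c v /\ H (p + v) = mps_sum c v.
  by apply: hv => j; apply: le_lt_trans (vm j) _; lra.
have H0 : H p = homog c v 0.
  have [] := hv (0 *: v); first by move=> j; rewrite scale0r mxE cmod0.
  move=> c0; rewrite scale0r addr0 => ->; rewrite -(scale0r v) mps_sumE//.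
  rewrite (@csum_finite _ _ 1) => [|i i1]; last by rewrite homogZ expr0n gtn_eqF ?mul0r.
  by rewrite big_ord1 homogZ expr0 mul1r.
rewrite -homog1E Hv mps_sumE// H0 (csum_split 2 (homog_asum cv)) !big_ord_recl big_ord0 addr0.
have -> : homog c v (ord0 : 'I_2) + homog c v (lift ord0 ord0 : 'I_2) +
    csum (fun i => homog c v (2 + i)%N) - homog c v 0 - homog c v 1 =
    csum (fun i => homog c v (2 + i)%N).
  by rewrite /bump /=; ring.
apply: cmod_csum_le => n.
pose q := 2 * m / e.
have q01 : 0 <= q <= 1.
  rewrite /q; apply/andP; split; first by rewrite divr_ge0 ?mulr_ge0// ltW.
  by rewrite ler_pdivrMr//; lra.
have hk k : cmod (homog c v k) <= q ^+ k * \sum_(s <- shl k) cmod (c s) * (e / 2) ^+ k.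
  rewrite mulr_sumr; apply: le_trans (cmod_sum _ _ _) _.
  rewrite big_seq [leRHS]big_seq; apply: ler_sum => s; rewrite mem_shl => /eqP sk.
  rewrite mulrCA -exprMn cmodM.
  have -> : q * (e / 2) = m by rewrite /q; field; exact: lt0r_neq0.
  apply: ler_wpM2l; first exact: cmod_ge0.
  by rewrite -sk cmod_monom_le.
have -> : 4 / e ^+ 2 * B * m ^+ 2 = q ^+ 2 * B.
  by rewrite /q; field; exact: lt0r_neq0.
apply: (@le_trans _ _ (\sum_(i < n) q ^+ 2 *
    \sum_(s <- shl (2 + i)) cmod (c s) * (e / 2) ^+ (2 + i))).
  apply: ler_sum => i _; apply: le_trans (hk _) _; apply: ler_wpM2r.
    apply: sumr_ge0 => s _; apply: mulr_ge0; first exact: cmod_ge0.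
    by apply: exprn_ge0; rewrite divr_ge0// ltW.
  rewrite exprD ler_piMr ?exprn_ge0//; first by case/andP: q01.
  by case/andP: q01 => *; rewrite exprn_ile1.
rewrite -mulr_sumr; apply: ler_wpM2l; first by rewrite exprn_ge0//; case/andP: q01.
apply: le_trans (hB (2 + n)%N); rewrite [leRHS]big_split_ord /= lerDr.
apply: sumr_ge0 => i _; apply: sumr_ge0 => s _; apply: mulr_ge0; first exact: cmod_ge0.
by apply: exprn_ge0; rewrite divr_ge0// ltW.
Qed.

(** This identifies the linear coefficients of the expansion with the partial derivatives that occur
    in [dir_vec]. *)
Lemma derive_first_order H p (l : 'I_d -> C) L e : 0 <= L -> 0 < e ->
  (forall v (m : R), (forall j, cmod (v 0 j) <= m) -> 0 <= m <= e ->
    cmod (H (p + v) - H p - \sum_j v 0 j * l j) <= L * m ^+ 2) ->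
  forall j, 'D_(delta_mx 0 j) H p = l j.
Proof.
move=> L0 e0 h j; apply/cvg_lim => //.
apply/cvgrPdist_lt => _ /gt0_ofrealP[t t0 ->].
rewrite /dnbhs near_withinE; apply/near_cplxP.
have L1 : 0 < L + 1 by rewrite ltr_wpDl.
exists (Num.min e (t / (L + 1))); first by rewrite lt_min e0 divr_gt0.
move=> y; rewrite subr0 lt_min => /andP[ye yt] y0; rewrite ofreal_cmod ltr_ofreal.
have := h (y *: delta_mx 0 j) (cmod y).
have -> : \sum_i (y *: delta_mx 0 j : 'rV[C]_d) 0 i * l i = y * l j.
  rewrite (bigD1 j)//= big1 => [|i ij]; first by rewrite !mxE !eqxx mulr1 addr0.
  by rewrite !mxE eqxx (negPf ij) mulr0 mul0r.
move=> /(_ _ _) hy.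
have {hy} : cmod (H (p + y *: delta_mx 0 j) - H p - y * l j) <= L * cmod y ^+ 2.
  apply: hy; last by rewrite cmod_ge0 ltW.
  move=> i; rewrite !mxE cmodM eqxx /=; case: (i == j).
    by rewrite cmod1 mulr1.
  by rewrite cmod0 mulr0 cmod_ge0.
have cy : 0 < cmod y by rewrite cmod_gt0.
have -> : l j - y^-1 *: ((H \o shift p) (y *: delta_mx 0 j) - H p) =
    - (y^-1 * (H (p + y *: delta_mx 0 j) - H p - y * l j)).
  rewrite /= [_ *: _ + p]addrC.
  rewrite -[y^-1 *: _]/(y^-1 * (H (p + y *: delta_mx 0 j) - H p)).
  by move: (H (p + _) - H p) => D; rewrite mulrBr mulrA mulVf// mul1r opprB.
move=> hy; rewrite cmodN cmodM cmodV [_^-1 * _]mulrC ltr_pdivrMr//.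
apply: le_lt_trans hy _.
rewrite expr2 mulrA ltr_pM2r//.
apply: (@le_lt_trans _ _ ((L + 1) * cmod y)); first by apply: ler_wpM2r; [exact: cmod_ge0|lra].
by rewrite mulrC -ltr_pdivlMr.
Qed.

Definition rrow w : 'rV[C]_d := \row_j ofreal (w j).

(** The k-th coefficient of F(t w) in t. Weights 1 give [shell_mass]; tilted weights give, up to a
    power of X, the generating function of one s_j over the shell. *)
Definition wmass a w k : R := \sum_(s <- shl k) a s * \prod_j w j ^+ s j.

Lemma monom_rrow w s : monom (rrow w) s = ofreal (\prod_j w j ^+ s j).
Proof. by rewrite /monom rmorph_prod; apply: eq_bigr => j _; rewrite mxE rmorphXn. Qed.

Lemma homog_rrow a w k : homog (fun s => ofreal (a s)) (rrow w) k = ofreal (wmass a w k).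
Proof.
by rewrite rmorph_sum; apply: eq_bigr => s _; rewrite rmorphM /= monom_rrow.
Qed.

Lemma wmass_ge0 a w k : (forall s, 0 <= a s) -> (forall j, 0 < w j) -> 0 <= wmass a w k.
Proof.
move=> a0 w0; apply: sumr_ge0 => s _; apply: mulr_ge0 => //.
by apply: prodr_ge0 => j _; rewrite exprn_ge0// ltW.
Qed.

Lemma mps_sum_ray a w (t : C) : mps_cvg (fun s => ofreal (a s)) (t *: rrow w) ->
  mps_sum (fun s => ofreal (a s)) (t *: rrow w) = psum (fun k => ofreal (wmass a w k)) t.
Proof.
move=> cv; rewrite mps_sumE//; apply: eq_csum => k.
by rewrite homogZ homog_rrow mulrC.
Qed.

Lemma mps_cvg_wmass_pbnd a w (r : R) : (forall s, 0 <= a s) -> (forall j, 0 < w j) -> 0 <= r ->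
  mps_cvg (fun s => ofreal (a s)) (ofreal r *: rrow w) ->
  exists B, pbnd (fun k => ofreal (wmass a w k)) r B.
Proof.
move=> a0 w0 r0 /homog_asum[B hB]; exists B => n; apply: le_trans (hB n.+1).
rewrite big_ord_recr /= homogZ homog_rrow cmodM cmodX [cmod (ofreal r)]cmod_ofreal (ger0_norm r0).
rewrite mulrC lerDr; apply: sumr_ge0 => i _; exact: cmod_ge0.
Qed.

(** Since [conv_domain] is an interior, convergence on the ray alone is not enough. Positivity of
    all w_j makes every y near t w coordinatewise dominated by r1 w with r1 < rho. *)
Lemma conv_domain_ray a w (rho : R) (t : C) : (forall s, 0 <= a s) -> (forall j, 0 < w j) ->
  (forall r, 0 < r < rho -> exists M, pbnd (fun k => ofreal (wmass a w k)) r M) ->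
  cmod t < rho -> conv_domain (fun s => ofreal (a s)) (t *: rrow w).
Proof.
move=> a0 w0 hr trho.
pose r1 := (2 * cmod t + rho) / 3; pose r2 := (cmod t + 2 * rho) / 3.
have t0 := cmod_ge0 t.
have [tr1 r12 r2rho r20] : [/\ cmod t < r1, r1 < r2, r2 < rho & 0 < r2].
  by split; rewrite /r1 /r2; lra.
have [M hM] : exists M, pbnd (fun k => ofreal (wmass a w k)) r2 M.
  by apply: hr; rewrite r20.
have [m m0 mw] : exists2 m, 0 < m & forall j, m <= w j.
  (* A positive lower bound for all w_j that also makes sense for an empty index set. *)
  exists (\prod_j Num.min (w j) 1).
    by apply: prodr_gt0 => j _; rewrite lt_min w0 ltr01.
  move=> j; rewrite (bigD1 j)//=; apply: (@le_trans _ _ (Num.min (w j) 1)).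
    rewrite ler_piMr//; first by rewrite le_min ler01 ltW ?w0.
    apply: prodr_ile1 => i _; rewrite le_min ler01 ltW ?w0//=.
    by rewrite ge_min lexx orbT.
  by rewrite ge_min lexx.
apply/near_row_cplxP; exists ((r1 - cmod t) * m); first by rewrite mulr_gt0// subr_gt0.
move=> y hy; apply: (@bound_mps_cvg _ _ (M / (1 - r1 / r2))) => n.
have yr j : cmod (y 0 j) <= r1 * w j.
  have := cmodD (y 0 j - (t *: rrow w) 0 j) ((t *: rrow w) 0 j); rewrite subrK.
  move=> /le_trans; apply.
  have -> : r1 * w j = (r1 - cmod t) * w j + cmod t * w j by ring.
  apply: lerD; last by rewrite !mxE cmodM cmod_ofreal gtr0_norm.
  apply: le_trans (ltW (hy j)) _; apply: ler_wpM2l => //; rewrite subr_ge0; exact: ltW.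
have r10 : 0 <= r1 by rewrite (le_trans t0)// ltW.
apply: le_trans (pbnd_sum_le n r20 hM (s := r1) _); last by rewrite r10.
apply: ler_sum => k _; rewrite cmod_ofreal ger0_norm ?wmass_ge0// /wmass mulr_suml.
rewrite big_seq [leRHS]big_seq; apply: ler_sum => s; rewrite mem_shl => /eqP sk.
rewrite cmodM cmod_ofreal ger0_norm// -mulrA; apply: ler_wpM2l => //.
rewrite /monom cmod_prod -sk /mdeg -prodrXr -big_split /=; apply: ler_prod => j _.
rewrite cmod_ge0 cmodX mulrC -exprMn lerXn2r ?nnegrE ?cmod_ge0//.
exact: le_trans (cmod_ge0 _) (yr j).
Qed.

(** Otherwise the ray series times H equals G near rho inside the disk, with H nonzero at rho, and
    Pringsheim's theorem would push the radius beyond rho, against its maximality. *)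
Lemma boundary_zero a w (rho : R) (U : set 'rV[C]_d) (G H : 'rV[C]_d -> C) :
  (forall s, 0 <= a s) -> (forall j, 0 < w j) -> 0 < rho ->
  (forall r, 0 < r < rho -> exists M, pbnd (fun k => ofreal (wmass a w k)) r M) ->
  (forall r M, rho < r -> ~ pbnd (fun k => ofreal (wmass a w k)) r M) ->
  open U -> analytic_on U G -> analytic_on U H ->
  (forall z, U z -> conv_domain (fun s => ofreal (a s)) z -> H z != 0 ->
     mps_sum (fun s => ofreal (a s)) z = G z / H z) ->
  U (ofreal rho *: rrow w) -> H (ofreal rho *: rrow w) = 0.
Proof.
move=> a0 w0 rho0 hin hout oU aG aH FGH Ux; apply/eqP/negPn/negP => Hx.
have eG := analytic_ray erefl (aG _ Ux).
have eH := analytic_ray erefl (aH _ Ux).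
have [L [dl [L0 dl0 hL]]] := has_expansion_lip eH.
have [e e0 he] : exists2 e : R, 0 < e &
    forall z, (forall j, cmod (z 0 j - (ofreal rho *: rrow w) 0 j) < e) -> U z.
  by apply/near_row_cplxP; apply: open_nbhs_nbhs; split.
pose W := 1 + \sum_j w j.
have W0 : 0 < W by rewrite /W ltr_pwDl// sumr_ge0// => j _; exact: ltW.
have wW j : w j <= W.
  rewrite /W (bigD1 j)//= addrCA lerDl addr_ge0// sumr_ge0// => i _; exact: ltW.
have L1 : 0 < L + 1 by rewrite ltr_wpDl.
pose h0 := cmod (H (ofreal rho *: rrow w)).
have h00 : 0 < h0 by rewrite cmod_gt0.
(* e / W keeps t w in U; h0 / (L + 1) keeps H nonzero there by the Lipschitz bound, which is valid
   up to dl. *)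
pose d1 := Num.min dl (Num.min (e / W) (h0 / (L + 1))).
have d10 : 0 < d1 by rewrite !lt_min dl0 !divr_gt0.
have [|r [M [rr]]] := @pringsheim R (wmass a w) _ _ rho d1 (fun k => wmass_ge0 k a0 w0)
  rho0 d10 hin eG eH Hx; last exact: hout.
move=> t; rewrite !lt_min => /and3P[td te th] trho.
have Ut : U (t *: rrow w).
  apply: he => j; rewrite !mxE -mulrBl cmodM cmod_ofreal gtr0_norm//.
  apply: (@le_lt_trans _ _ (cmod (t - ofreal rho) * W)); last by rewrite -ltr_pdivlMr.
  by apply: ler_wpM2l; rewrite ?cmod_ge0.
have Dt := conv_domain_ray a0 w0 hin trho.
have Ht : H (t *: rrow w) != 0.
  apply/negP => /eqP Ht; have := hL t (ltW td); rewrite Ht sub0r cmodN -/h0.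
  apply/negP; rewrite -ltNge; apply: (@le_lt_trans _ _ ((L + 1) * cmod (t - ofreal rho))).
    by apply: ler_wpM2r; [exact: cmod_ge0|lra].
  by rewrite mulrC -ltr_pdivlMr.
have := FGH _ Ut Dt Ht; rewrite (mps_sum_ray (interior_subset Dt)) => ->.
by rewrite divfK.
Qed.

End SeveralVariables.

(** * Coefficient asymptotics at a simple pole, and radii of comparable series *)

Section PoleAsymptotics.
Variable R : realType.
Local Notation C := (cplx R).
Implicit Types (f g h : C -> C) (p x z : C).

Lemma has_expansionM f g p : has_expansion f p -> has_expansion g p ->
  has_expansion (fun z => f z * g z) p.
Proof.
move=> [c [r [M [r0 cM hf]]]] [c' [r' [M' [r'0 cM' hg]]]].
pose s := Num.min r r'.
have s0 : 0 < s by rewrite lt_min r0.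
have [sr sr'] : s <= r /\ s <= r' by rewrite !ge_min !lexx orbT.
have {}cM : pbnd c s M by apply: pbnd_sub cM; rewrite ltW.
have {}cM' : pbnd c' s M' by apply: pbnd_sub cM'; rewrite ltW.
have s2 : cmod (ofreal (s / 2)) = s / 2 by rewrite cmod_ofreal gtr0_norm// divr_gt0.
have s2s : cmod (ofreal (s / 2)) < s by rewrite s2; lra.
have [B hB] := conv_pbnd s0 cM cM' s2s; rewrite s2 in hB.
exists (conv c c'), (s / 2), B; split=> //; first by rewrite divr_gt0.
move=> z zs; have zs' : cmod (z - p) < s by lra.
by rewrite hf ?hg ?(psum_conv s0 cM cM')// (lt_le_trans zs').
Qed.

Lemma has_expansion_near f g p (e : R) : 0 < e -> has_expansion f p ->
  (forall z, cmod (z - p) < e -> g z = f z) -> has_expansion g p.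
Proof.
move=> e0 [c [r [M [r0 cM hf]]]] fg.
exists c, (Num.min r e), M; split.
- by rewrite lt_min r0.
- by apply: pbnd_sub cM; rewrite ge_min lexx andbT le_min !ltW.
- by move=> z; rewrite lt_min => /andP[zr ze]; rewrite fg// hf.
Qed.

(** The Taylor coefficients of x0 - z at p. *)
Definition linear_coef x0 p (n : nat) : C :=
  if n is n'.+1 then (if n' is 0%N then -1 else 0) else x0 - p.

Lemma linear_pbnd x0 p : pbnd (linear_coef x0 p) 1 (cmod (x0 - p) + 1).
Proof.
move=> [|[|n]]; rewrite expr1n mulr1 /=.
- by rewrite lerDl.
- by rewrite cmodN cmod1 lerDr cmod_ge0.
- by rewrite cmod0 addr_ge0 ?cmod_ge0.
Qed.

Lemma linear_psum x0 p z : psum (linear_coef x0 p) (z - p) = x0 - z.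
Proof.
rewrite /psum (@csum_finite _ _ 2) => [|[|[|n]]//]; last by rewrite /= mul0r.
by rewrite !big_ord_recl big_ord0 /= expr0 expr1; ring.
Qed.

Lemma has_expansion_linear x0 p : has_expansion (fun z => x0 - z) p.
Proof.
exists (linear_coef x0 p), 1, (cmod (x0 - p) + 1); split=> //.
  exact: linear_pbnd.
by move=> z _; rewrite linear_psum.
Qed.

Lemma has_expansionN f p : has_expansion f p -> has_expansion (fun z => - f z) p.
Proof.
move=> [c [r [M [r0 cM hf']]]].
exists (fun n => -1 * c n), r, M; split=> //.
  by move=> n; rewrite mulN1r cmodN cM.
move=> z zr; rewrite hf'// /psum -[LHS]mulN1r -csumZ; last exact: pbnd_asum cM zr.
by apply: eq_csum => n; rewrite mulrA.
Qed.

(* The coefficients of (x0 - z) g(z) decay geometrically at x0, and their partial sums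
   there are c_n x0^(n+1). *)
Lemma pole_asymptotics (c : nat -> R) g h x0 (r0 M0 : R) : (forall n, 0 <= c n) ->
  0 < r0 -> pbnd (fun n => ofreal (c n)) r0 M0 ->
  (forall z, cmod z < r0 -> g z = psum (fun n => ofreal (c n)) z) ->
  (forall z, cmod z <= cmod x0 -> z != x0 -> has_expansion g z) ->
  has_expansion h x0 -> h x0 != 0 ->
  (\forall z \near x0, z != x0 -> g z = h z / (z - x0)) -> x0 != 0 ->
  exists X m M N, [/\ x0 = ofreal X, 0 < X, 0 < m, forall n, c n * X ^+ n <= M
    & forall n, (N <= n)%N -> m <= c n * X ^+ n].
Proof.
move=> c0 r00 cM gc hg hh hx0 /near_cplxP[e e0 he] x00.
have X0 : 0 < cmod x0 by rewrite cmod_gt0.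
(* The removable singularity at x0 is filled with its limit. *)
pose f z := if z == x0 then - h x0 else g z * (x0 - z).
have hf z : cmod z <= cmod x0 -> has_expansion f z.
  move=> zx; have [->|zx0] := eqVneq z x0.
    apply: (has_expansion_near e0 (has_expansionN hh)) => y yx; rewrite /f.
    have [->//|yx0] := eqVneq y x0; rewrite he//.
    by rewrite -(opprB y x0) mulrN divfK// subr_eq0.
  have zx1 : 0 < cmod (z - x0) by rewrite cmod_gt0 subr_eq0.
  apply: (has_expansion_near zx1 (has_expansionM (hg _ zx zx0) (has_expansion_linear x0 z))).
  move=> y yz; rewrite /f; case: eqP => // yx; move: yz.
  by rewrite yx cmod_distrC ltxx.
pose v := linear_coef x0 0; pose E := conv (fun n => ofreal (c n)) v.
pose s := Num.min r0 1.
have s0 : 0 < s by rewrite lt_min r00 ltr01.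
have [sr s1] : s <= r0 /\ s <= 1 by rewrite !ge_min !lexx orbT.
have cM' : pbnd (fun n => ofreal (c n)) s M0 by apply: pbnd_sub cM; rewrite ltW.
have vM : pbnd v s (cmod (x0 - 0) + 1) by apply: pbnd_sub (linear_pbnd x0 0); rewrite ltW.
pose s' := Num.min (s / 2) (cmod x0).
have s'0 : 0 < s' by rewrite lt_min X0 divr_gt0.
have [s's s'x] : s' <= s / 2 /\ s' <= cmod x0 by rewrite !ge_min !lexx orbT.
have cs' : cmod (ofreal s') = s' by rewrite cmod_ofreal gtr0_norm.
have s's' : cmod (ofreal s') < s by rewrite cs'; lra.
have [B hB] := conv_pbnd s0 cM' vM s's'; rewrite cs' in hB.
have fE z : cmod z < s' -> f z = psum E z.
  move=> zs; have zs2 : cmod z < s by lra.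
  rewrite /E -(psum_conv s0 cM' vM zs2) -gc; last exact: lt_le_trans sr.
  rewrite -[z in psum v z]subr0 linear_psum /f; case: eqP => // zx.
  by move: zs; rewrite zx ltNge s'x.
have [r1 [M1 [xr1 EM fE']]] := disk_continuation s'0 hB fE hf.
have r10 : 0 < r1 by apply: lt_trans xr1.
have sE : asum (fun n => E n * x0 ^+ n) := pbnd_asum r10 EM xr1.
have sumE : csum (fun n => E n * x0 ^+ n) = - h x0.
  by have := fE' _ xr1; rewrite /f eqxx => ->.
have En n : E n = if n is n'.+1 then ofreal (c n) * x0 - ofreal (c n') else ofreal (c 0%N) * x0.
  case: n => [|n]; rewrite /E /conv.
    by rewrite big_ord1 /= subr0.
  rewrite big_ord_recr big_ord_recr /= subnn subSnn /= subr0 big1 => [|i _].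
    by rewrite add0r mulrN1 addrC.
  have in1 := ltn_ord i; rewrite subSn 1?ltnW// -subnSK//=; exact: mulr0.
have part n : \sum_(i < n.+1) E i * x0 ^+ i = ofreal (c n) * x0 ^+ n.+1.
  elim: n => [|n IH]; first by rewrite big_ord1 En expr0 expr1 mulr1.
  rewrite big_ord_recr IH /= En !exprS; ring.
set X := cmod x0.
have [l El] : exists l, l = - h x0 / x0 by eexists.
have l0 : 0 < cmod l by rewrite El cmod_gt0 mulf_neq0 ?oppr_eq0// invr_eq0.
have cX n : cmod (ofreal (c n) * x0 ^+ n) = c n * X ^+ n.
  by rewrite cmodM cmodX cmod_ofreal ger0_norm.
have lim (eps : R) : 0 < eps -> exists N, forall n, (N <= n)%N ->
    cmod (ofreal (c n) * x0 ^+ n - l) < eps.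
  move=> eps0; have [N hN] := csum_near sE (mulr_gt0 eps0 X0).
  exists N => n Nn; have := hN n.+1 (leqW Nn); rewrite part sumE.
  have -> : ofreal (c n) * x0 ^+ n.+1 - - h x0 = (ofreal (c n) * x0 ^+ n - l) * x0.
    by rewrite El exprSr; field.
  by rewrite cmodM ltr_pM2r.
have [N hN] := lim (cmod l / 2) (divr_gt0 l0 (ltr0n _ 2)).
exists X, (cmod l / 2), (((\sum_(i < N) c i * X ^+ i)) + 2 * cmod l), N; split.
(* Positivity of x0: c_n x0^n tends to l and c_n >= 0, so |l| u^n tends to l; two consecutive n then
   give |l| |u - 1| <= eps |l| for every eps > 0. *)
- pose u := x0 / ofreal X.
  have oX : ofreal X != 0 by rewrite -cmod_eq0 cmod_ofreal normr_eq0 gt_eqF.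
  have cu : cmod u = 1.
    by rewrite cmodM cmodV cmod_ofreal (gtr0_norm X0) divff// gt_eqF.
  suff u1 : u = 1 by move/(congr1 ( *%R^~ (ofreal X))): u1; rewrite /u divfK// mul1r.
  apply/eqP; rewrite -subr_eq0 -cmod_eq0 eq_le cmod_ge0 andbT.
  apply/ler_addgt0Pl => eps eps0; rewrite addr0.
  have [N1 hN1] := lim (eps * cmod l / 4) (divr_gt0 (mulr_gt0 eps0 l0) (ltr0n _ 4)).
  have key n : (N1 <= n)%N -> cmod (ofreal (cmod l) * u ^+ n - l) <= eps * cmod l / 2.
    move=> /hN1 h1.
    have xu : ofreal (c n) * x0 ^+ n = ofreal (c n * X ^+ n) * u ^+ n.
      by rewrite /u exprMn exprVn rmorphM rmorphXn -mulrA [_ * (_ * _^-1)]mulrCA mulfV ?expf_neq0// mulr1.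
    have h2 : cmod (ofreal (cmod l) * u ^+ n - ofreal (c n) * x0 ^+ n) <= eps * cmod l / 4.
      rewrite xu -mulrBl -rmorphB cmodM cmodX cu expr1n mulr1 cmod_ofreal.
      rewrite -cX ler_norml; apply/andP; split.
        have := cmodB_ge (ofreal (c n) * x0 ^+ n) l; move: h1; lra.
      have := cmodB_ge l (ofreal (c n) * x0 ^+ n); rewrite (cmod_distrC l); move: h1; lra.
    apply: le_trans (cmod_dist3 (ofreal (c n) * x0 ^+ n) _ _) _; move: h1 h2; lra.
  have k1 := key N1 (leqnn _); have k2 := key N1.+1 (leqnSn _).
  rewrite -(ler_pM2l l0).
  have <- : cmod (ofreal (cmod l) * u ^+ N1.+1 - ofreal (cmod l) * u ^+ N1) = cmod l * cmod (u - 1).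
    have -> : ofreal (cmod l) * u ^+ N1.+1 - ofreal (cmod l) * u ^+ N1 = ofreal (cmod l) * (u ^+ N1 * (u - 1)).
      by rewrite exprS; ring.
    by rewrite !cmodM cmodX cu expr1n mul1r cmod_ofreal gtr0_norm.
  apply: le_trans (cmod_dist3 l _ _) _; rewrite (cmod_distrC l).
  apply: le_trans (lerD k2 k1) _; lra.
- exact: X0.
- exact: divr_gt0 l0 (ltr0n _ 2).
- move=> n; have t0 i : 0 <= c i * X ^+ i by rewrite mulr_ge0 ?exprn_ge0// ltW.
  have [Nn|nN] := leqP N n.
    apply: ler_wpDl; first by apply: sumr_ge0 => i _.
    have := hN _ Nn; have := cmodB_ge (ofreal (c n) * x0 ^+ n) l; rewrite cX; lra.
  apply: ler_wpDr; first by rewrite mulr_ge0 ?cmod_ge0.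
  rewrite (bigD1 (Ordinal nN))//= lerDl; exact: sumr_ge0.
- move=> n Nn; have := hN _ Nn; have := cmodB_ge l (ofreal (c n) * x0 ^+ n).
  rewrite (cmod_distrC l) cX; lra.
Qed.

Lemma expr_unbounded (x B : R) : 1 < x -> exists k, B < x ^+ k.
Proof.
move=> x1; have bern k : 1 + (x - 1) *+ k <= x ^+ k.
  elim: k => [|k IH]; first by rewrite mulr0n addr0.
  rewrite exprS; apply: (@le_trans _ _ (x * (1 + (x - 1) *+ k))); last first.
    by rewrite ler_pM2l//; lra.
  have : 0 <= (x - 1) *+ k by rewrite mulrn_wge0//; lra.
  rewrite mulrS; nra.
exists (Num.truncn (`|B| / (x - 1))).+1; apply: lt_le_trans (bern _).
have x10 : 0 < x - 1 by lra.
have : `|B| / (x - 1) < (Num.truncn (`|B| / (x - 1))).+1%:R by rewrite truncnS_gt// divr_ge0// ltW.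
rewrite ltr_pdivrMr// mulr_natl => h; apply: le_lt_trans (ler_norm B) _; apply: lt_trans h _.
by rewrite ltrDr.
Qed.

(** rho, the radius of convergence of the series of b, is the supremum of the radii with bounded
    terms. The upper bound on c puts 1 / hi among them; the lower bound m excludes everything beyond
    1 / lo. *)
Lemma tilted_radius (b c : nat -> R) (m M lo hi : R) N : 0 < m -> 0 < lo -> lo <= hi ->
  (forall n, 0 <= b n) -> (forall n, 0 <= c n) ->
  (forall n, c n <= M) -> (forall n, (N <= n)%N -> m <= c n) ->
  (forall n, lo ^+ n * c n <= b n <= hi ^+ n * c n) ->
  exists rho, [/\ hi^-1 <= rho <= lo^-1,
    forall r, 0 < r < rho -> exists B, pbnd (fun n => ofreal (b n)) r B
    & forall r B, rho < r -> ~ pbnd (fun n => ofreal (b n)) r B].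
Proof.
move=> m0 lo0 lohi b0 c0 cM cm hb.
have hi0 : 0 < hi by apply: lt_le_trans lohi.
pose A := [set r : R | 0 <= r /\ exists B, pbnd (fun n => ofreal (b n)) r B].
have Ahi : A hi^-1.
  split; first by rewrite invr_ge0 ltW.
  exists M => n; rewrite cmod_ofreal ger0_norm// exprVn ler_pdivrMr ?exprn_gt0//.
  have /andP[_ /le_trans] := hb n; apply; rewrite mulrC.
  by apply: ler_wpM2r; rewrite ?exprn_ge0// ltW.
have Alo r : A r -> r <= lo^-1.
  move=> [r0 [B hB]]; rewrite leNgt; apply/negP => lor.
  have x1 : 1 < r * lo by rewrite -ltr_pdivrMr// div1r.
  have [k hk] := expr_unbounded (B / m) x1.
  have : B / m < (r * lo) ^+ maxn k N.
    by apply: lt_le_trans hk _; apply: ler_weXn2l; [exact: ltW|exact: leq_maxl].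
  rewrite ltr_pdivrMr//; apply/negP; rewrite -leNgt; apply: le_trans (hB (maxn k N)).
  rewrite cmod_ofreal ger0_norm// exprMn [leRHS]mulrC -mulrA.
  apply: ler_wpM2l; first exact: exprn_ge0.
  have /andP[hb1 _] := hb (maxn k N); apply: le_trans hb1.
  by apply: ler_wpM2l; [exact/exprn_ge0/ltW|exact/cm/leq_maxr].
have hA : has_sup A by split; [exists hi^-1|exists lo^-1].
exists (sup A); split.
- apply/andP; split; first by apply: sup_ubound => //; exact: hA.2.
  by apply: ge_sup => //; exists hi^-1.
- move=> r /andP[r0 rs]; have e0 : 0 < sup A - r by rewrite subr_gt0.
  have [r' [r'0 [B hB]]] := sup_adherent e0 hA; rewrite subKr => rr'.
  by exists B; apply: pbnd_sub hB; rewrite !ltW.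
- move=> r B sr hB; have : r <= sup A.
    apply: sup_ubound; first exact: hA.2.
    split; last by exists B.
    apply: le_trans (ltW sr); apply: (@le_trans _ _ hi^-1); first by rewrite invr_ge0 ltW.
    by apply: sup_ubound => //; exact: hA.2.
  by rewrite leNgt sr.
Qed.

End PoleAsymptotics.

(** * Tilted weights: radius, direction and concentration *)

Section Tilting.
Variables (R : realType) (d : nat) (a : multiindex d -> R) (X m M : R) (N : nat).
Hypotheses (a_ge0 : forall s, 0 <= a s) (X0 : 0 < X) (m0 : 0 < m).
Hypotheses (cM : forall n, shell_mass a n * X ^+ n <= M).
Hypotheses (cm : forall n, (N <= n)%N -> m <= shell_mass a n * X ^+ n).
Local Notation C := (cplx R).
Implicit Types (j : 'I_d) (t q rho e K : R) (s : multiindex d) (k : nat).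

Lemma expR_taylor1 t : `|t| <= 1 / 2 -> `|expR t - 1 - t| <= 2 * t ^+ 2.
Proof.
rewrite ler_norml => /andP[t1 t2].
have h1 := expR_ge1Dx t; have h2 := expR_ge1Dx (- t).
have h3 : expR t * (1 - t) <= 1.
  rewrite -[leRHS](divff (lt0r_neq0 (expR_gt0 t))) -expRN.
  by rewrite ler_pM2l ?expR_gt0.
rewrite ler_norml; apply/andP; split.
  have := sqr_ge0 t; lra.
have t10 : 0 < 1 - t by lra.
rewrite -(ler_pM2r t10); move: h3; set y := expR t => h3.
have := mulr_ge0 (sqr_ge0 t) (_ : 0 <= 1 - 2 * t); rewrite expr2 => /(_ (ltac:(lra))); lra.
Qed.

Definition tilt j0 t j : R := X * (if j == j0 then expR t else 1).

Lemma tilt_gt0 j0 t j : 0 < tilt j0 t j.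
Proof. by rewrite mulr_gt0//; case: ifP => _ //; exact: expR_gt0. Qed.

Lemma shell_massE k : shell_mass a k = \sum_(s <- shl d k) a s.
Proof. exact: shell_sumE. Qed.

Lemma wmass_tilt j0 t k :
  wmass a (tilt j0 t) k = X ^+ k * \sum_(s <- shl d k) a s * expR t ^+ s j0.
Proof.
rewrite mulr_sumr; apply: eq_big_seq => s; rewrite mem_shl => /eqP sk.
rewrite mulrCA; congr (_ * _); under eq_bigr do rewrite exprMn.
rewrite big_split /= prodrXr -/(mdeg s) sk; congr (_ * _).
rewrite (bigD1 j0)//= eqxx big1 ?mulr1// => i ij.
by rewrite (negPf ij) expr1n.
Qed.

Lemma le_mdeg s j : (s j <= mdeg s)%N.
Proof. by rewrite /mdeg (bigD1 j)//= leq_addr. Qed.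

Definition converges_below (b : nat -> R) rho :=
  forall r, 0 < r < rho -> exists B, pbnd (fun n => ofreal (b n)) r B.

(** On the shell of degree k, s_j lies between 0 and k, so exp (t s_j) lies between the k-th powers
    of min (1, exp t) and max (1, exp t). *)
Lemma tilt_radius j0 t : exists rho,
  [/\ (Num.max 1 (expR t))^-1 <= rho <= (Num.min 1 (expR t))^-1,
      converges_below (wmass a (tilt j0 t)) rho
    & forall r B, rho < r -> ~ pbnd (fun n => ofreal (wmass a (tilt j0 t) n)) r B].
Proof.
have e0 := expR_gt0 t.
have lo0 : 0 < Num.min 1 (expR t) by rewrite lt_min ltr01.
have hi0 : 0 < Num.max 1 (expR t) by rewrite lt_max ltr01.
apply: (tilted_radius (c := fun n => shell_mass a n * X ^+ n) m0 lo0) cM cm _.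
- by rewrite ge_min le_max lexx.
- by move=> n; apply: wmass_ge0 => // j; exact: tilt_gt0.
- move=> n; apply: mulr_ge0; last exact/exprn_ge0/ltW.
  by rewrite shell_massE; apply: sumr_ge0.
move=> n; rewrite wmass_tilt shell_massE [_ * X ^+ n]mulrC; apply/andP; split.
  rewrite mulrCA; apply: ler_wpM2l; first exact/exprn_ge0/ltW.
  rewrite mulr_sumr big_seq [leRHS]big_seq; apply: ler_sum => s.
  rewrite mem_shl => /eqP sn; rewrite mulrC; apply: ler_wpM2l => //.
  apply: (@le_trans _ _ (Num.min 1 (expR t) ^+ s j0)).
    by apply: ler_wiXn2l; [exact: ltW|rewrite ge_min lexx|rewrite -sn le_mdeg].
  by rewrite lerXn2r ?nnegrE ?(ltW e0) ?(ltW lo0)// ge_min lexx orbT.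
rewrite mulrCA; apply: ler_wpM2l; first exact/exprn_ge0/ltW.
rewrite mulr_sumr big_seq [leRHS]big_seq; apply: ler_sum => s.
rewrite mem_shl => /eqP sn; rewrite [leRHS]mulrC; apply: ler_wpM2l => //.
apply: (@le_trans _ _ (Num.max 1 (expR t) ^+ s j0)).
  by rewrite lerXn2r ?nnegrE ?(ltW e0) ?(ltW hi0)// le_max lexx orbT.
by apply: ler_weXn2l; [rewrite le_max lexx|rewrite -sn le_mdeg].
Qed.

(** rho - 1 and rho exp t - 1 are the relative displacements of the coordinates of the boundary
    point from X. The last clause later gives p_j its sign. *)
Lemma tilt_radius_near t rho : `|t| <= 1 / 2 ->
  (Num.max 1 (expR t))^-1 <= rho <= (Num.min 1 (expR t))^-1 ->
  [/\ 0 < rho, `|rho - 1| <= 2 * `|t|, `|rho * expR t - 1| <= 2 * `|t| & 0 <= t -> rho <= 1].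
Proof.
move=> t2 /andP[lo hi]; have e0 := expR_gt0 t.
have := expR_taylor1 t2; have := expR_ge1Dx t; move: t2 lo hi.
have [t0|t0] := leP 0 t.
  have e1 : 1 <= expR t by rewrite -expR0 ler_expR.
  rewrite (max_idPr e1) (min_idPl e1) invr1 !ler_norml => /andP[_ t2].
  rewrite -div1r ler_pdivrMr// => lo hi _ /andP[_].
  have tt : t ^+ 2 <= t / 2 by rewrite expr2; apply: ler_wpM2l => //; lra.
  set y := expR t in e0 e1 lo *; move=> hy.
  have rho0 : 0 < rho by rewrite -(pmulr_lgt0 _ e0) (lt_le_trans ltr01).
  have r1 : rho * y <= y by rewrite ler_piMl// ltW.
  have r2 : rho * (y - 1) <= y - 1 by apply: ler_piMl => //; lra.
  by rewrite (ger0_norm t0); split=> //; apply/andP; split; lra.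
have e1 : expR t <= 1 by rewrite -expR0 ler_expR ltW.
rewrite (max_idPl e1) (min_idPr e1) invr1 => t2.
rewrite -[X in _ -> _ <= X -> _]div1r ler_pdivlMr// => lo hi h1 _.
move: t2; rewrite (ltr0_norm t0) => t2; set y := expR t in e0 e1 hi h1 *.
have rho0 : 0 < rho by apply: lt_le_trans lo.
have r2 : rho * (1 - y) <= rho * - t by apply: ler_wpM2l; [exact: ltW|lra].
have r3 : rho * (1 / 2) <= rho * y by apply: ler_wpM2l; [exact: ltW|lra].
have r4 : rho * - t <= 2 * - t by apply: ler_wpM2r; lra.
have r5 : y <= rho * y by rewrite ler_peMl// ltW.
by rewrite !ler_norml; split=> //; apply/andP; split; lra.
Qed.

(** * The direction from the linearization of H *)

Section Gradient.
Variables (U : set 'rV[C]_d) (G H : 'rV[C]_d -> C) (l : 'I_d -> C) (L e : R).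
Let x : 'rV[C]_d := const_mx (ofreal X).
Hypotheses (oU : open U) (Ux : U x) (aG : analytic_on U G) (aH : analytic_on U H).
Hypothesis FGH : forall z, U z -> conv_domain (fun s => ofreal (a s)) z -> H z != 0 ->
  mps_sum (fun s => ofreal (a s)) z = G z / H z.
Hypotheses (L0 : 0 <= L) (e0 : 0 < e).
Hypothesis Hl : forall (v : 'rV[C]_d) (r : R), (forall j, cmod (v 0 j) <= r) -> 0 <= r <= e ->
  cmod (H (x + v) - H x - \sum_j v 0 j * l j) <= L * r ^+ 2.
Let S := \sum_j l j.

(* H vanishes on the boundary of the domain of convergence; this equation is its
   linearization at x. *)
Lemma radius_first_order : exists K e1, [/\ 0 <= K, 0 < e1, e1 <= 1 / 2 & forall j t, `|t| <= e1 ->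
  exists rho, [/\ 0 < rho, `|rho - 1| <= 2 * `|t|, 0 <= t -> rho <= 1,
    converges_below (wmass a (tilt j t)) rho
  & cmod (ofreal (rho - 1) * S + ofreal (rho * (expR t - 1)) * l j) <= K * t ^+ 2]].
Proof.
have [eU eU0 hU] : exists2 eU : R, 0 < eU &
    forall z : 'rV[C]_d, (forall j, cmod (z 0 j - x 0 j) < eU) -> U z.
  by apply/near_row_cplxP; apply: open_nbhs_nbhs; split.
(* The displacement from x is at most 2 X |t|: the last two bounds keep it within the range of the
   expansion of H and within U, and 1 / 2 serves the estimates on exp t. *)
pose e1 := Num.min (1 / 2) (Num.min (e / (2 * X)) (eU / (4 * X))).
have e10 : 0 < e1 by rewrite !lt_min !divr_gt0 ?mulr_gt0.
have [e1h e1e e1U] : [/\ e1 <= 1 / 2, e1 <= e / (2 * X) & e1 <= eU / (4 * X)].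
  by split; rewrite !ge_min lexx ?orbT.
have base j t : `|t| <= e1 -> exists rho, [/\ 0 < rho, `|rho - 1| <= 2 * `|t|,
    0 <= t -> rho <= 1, converges_below (wmass a (tilt j t)) rho &
    exists v : 'rV[C]_d, [/\ H (x + v) = 0, forall i, cmod (v 0 i) <= 2 * X * `|t| &
    \sum_i v 0 i * l i = ofreal X * (ofreal (rho - 1) * S + ofreal (rho * (expR t - 1)) * l j)]].
  move=> te; have [rho [lohi hin hout]] := tilt_radius j t.
  have [rho0 r1 r2 r3] := tilt_radius_near (le_trans te e1h) lohi.
  exists rho; split=> //.
  pose v : 'rV[C]_d := \row_i ofreal (X * (rho * (if i == j then expR t else 1) - 1)).
  have xv : ofreal rho *: rrow (tilt j t) = x + v.
    apply/rowP => i; rewrite !mxE -!rmorphM -rmorphD; congr ofreal; rewrite /tilt; ring.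
  have vX i : cmod (v 0 i) <= 2 * X * `|t|.
    rewrite mxE cmod_ofreal normrM (gtr0_norm X0) -mulrA mulrCA ler_pM2l//.
    by case: ifP => _; rewrite ?mulr1.
  exists v; split=> //.
    rewrite -xv; apply: (boundary_zero a_ge0 (tilt_gt0 j t) rho0 hin hout oU aG aH FGH).
    rewrite xv; apply: hU => i; rewrite mxE addrAC subrr add0r.
    apply: le_lt_trans (vX i) _.
    have : 2 * X * `|t| <= 2 * X * (eU / (4 * X)).
      by apply: ler_wpM2l; [rewrite mulr_ge0// ltW|exact: le_trans e1U].
    have -> : 2 * X * (eU / (4 * X)) = eU / 2 by field; exact: lt0r_neq0.
    lra.
  rewrite /S mulrDr !mulr_sumr.
  rewrite (bigD1 j)//= [in RHS](bigD1 j)//= !mxE eqxx.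
  rewrite addrAC; congr (_ + _).
    have -> : ofreal (X * (rho * expR t - 1)) =
        ofreal X * (ofreal (rho - 1) + ofreal (rho * (expR t - 1))).
      by rewrite -rmorphD -rmorphM; congr ofreal; ring.
    by ring.
  apply: eq_bigr => i ij; rewrite mxE (negPf ij) mulr1.
  by rewrite rmorphM; ring.
exists (4 * L * X), e1; split=> //; first by rewrite !mulr_ge0// ltW.
move=> j t te; have [rho [rho0 r1 r3 hin [v [Hv vX vl]]]] := base j t te.
exists rho; split=> //.
(* At t = 0 the bound on v forces v = 0, so the zero found is x itself. *)
have Hx : H x = 0.
  have t0 : `|0 : R| <= e1 by rewrite normr0 ltW.
  have [rho' [_ _ _ _ [v' [Hv' v'X _]]]] := base j 0 t0.
  suff v'0 : v' = 0 by rewrite -Hv' v'0 addr0.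
  apply/rowP => i; apply/eqP; rewrite mxE -cmod_eq0 eq_le cmod_ge0 andbT.
  by have := v'X i; rewrite normr0 mulr0.
have := Hl vX; rewrite Hv Hx subr0 sub0r cmodN vl cmodM cmod_ofreal (gtr0_norm X0).
have -> : L * (2 * X * `|t|) ^+ 2 = X * (4 * L * X * t ^+ 2).
  by rewrite -[t ^+ 2]real_normK ?num_real//; ring.
rewrite ler_pM2l//; apply; apply/andP; split; first by rewrite !mulr_ge0// ltW.
have : 2 * X * `|t| <= 2 * X * (e / (2 * X)).
  by apply: ler_wpM2l; [rewrite mulr_ge0// ltW|exact: le_trans e1e].
by rewrite [X in _ <= X -> _]mulrC divfK// mulf_neq0// lt0r_neq0.
Qed.

Lemma le0_of_small (y K e1 : R) : 0 <= K -> 0 < e1 ->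
  (forall t, 0 < t <= e1 -> y <= K * t) -> y <= 0.
Proof.
move=> K0 e10 h; rewrite leNgt; apply/negP => y0.
have K1 : 0 < K + 1 by lra.
pose t := Num.min e1 (y / (2 * (K + 1))).
have t0 : 0 < t by rewrite lt_min e10 divr_gt0// mulr_gt0.
have te : 0 < t <= e1 by rewrite t0 ge_min lexx.
have ty : t <= y / (2 * (K + 1)) by rewrite ge_min lexx orbT.
move: ty; rewrite ler_pdivlMr ?mulr_gt0// => ty.
have := h t te; nra.
Qed.

Hypothesis lN0 : exists j, l j != 0.

(** All is read off from (rho - 1) S + rho (exp t - 1) l_j = O(t^2) with rho real and rho (exp t -
    1) = t + O(t^2). If S = 0, every l_j vanishes. After division by S, the imaginary part shows
    that l_j / S is real, the real part expands rho, and rho <= 1 for t >= 0 gives p >= 0. *)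
Lemma gradient_direction : S != 0 /\ forall j, exists p : R, [/\ 0 <= p, l j = ofreal p * S
  & exists K e1, [/\ 0 <= K, 0 < e1 & forall t, `|t| <= e1 -> exists rho,
    converges_below (wmass a (tilt j t)) rho /\ `|rho - (1 - t * p)| <= K * t ^+ 2]].
Proof.
have [K [e1 [K0 e10 e1h hK]]] := radius_first_order.
have aux j t rho : `|t| <= 1 / 2 -> `|rho - 1| <= 2 * `|t| ->
    `|rho * (expR t - 1) - t| <= 6 * t ^+ 2.
  move=> t2 r1; have h := expR_taylor1 t2.
  have -> : rho * (expR t - 1) - t = (rho - 1) * (expR t - 1) + (expR t - 1 - t) by ring.
  have tt : t ^+ 2 = `|t| ^+ 2 by rewrite real_normK ?num_real.
  have t3 : 2 * t ^+ 2 <= `|t|.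
    by rewrite tt expr2 mulrA -[leRHS]mul1r; apply: ler_wpM2r => //; lra.
  have h2 : `|expR t - 1| <= 2 * `|t|.
    have := ler_normD (expR t - 1 - t) t; rewrite subrK; lra.
  apply: le_trans (ler_normD _ _) _; rewrite normrM.
  have : `|rho - 1| * `|expR t - 1| <= (2 * `|t|) * (2 * `|t|) by apply: ler_pM.
  by move: h; rewrite tt; lra.
(* 1 / 12 makes the error 6 t^2 at most t / 2. *)
pose e2 := Num.min e1 (1 / 12).
have e20 : 0 < e2 by rewrite lt_min e10 divr_gt0.
have [e21 e2h] : e2 <= e1 /\ e2 <= 1 / 12 by rewrite !ge_min !lexx orbT.
have half j t rho : 0 < t <= e2 -> `|rho - 1| <= 2 * `|t| -> t / 2 <= rho * (expR t - 1).
  move=> /andP[t0 te] r1.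
  have t2 : `|t| <= 1 / 2 by rewrite gtr0_norm//; lra.
  have := aux j t rho t2 r1; rewrite ler_norml => /andP[h _].
  have : 6 * t ^+ 2 <= t / 2 by rewrite expr2 mulrA [t / 2]mulrC; apply: ler_wpM2r; lra.
  lra.
have S0 : S != 0.
  apply/eqP => S0; have [j /negP] := lN0; apply.
  rewrite -cmod_eq0 eq_le cmod_ge0 andbT.
  apply: (@le0_of_small _ (2 * K) e2) => //; first by rewrite mulr_ge0.
  move=> t te; have /andP[t0 te2] := te.
  have [|rho [rho0 r1 _ _]] := hK j t; first by rewrite gtr0_norm//; lra.
  rewrite S0 mulr0 add0r cmodM cmod_ofreal => h.
  have h2 := half j t rho te r1.
  have h3 : t / 2 * cmod (l j) <= K * t ^+ 2.
    apply: le_trans h; apply: ler_wpM2r; first exact: cmod_ge0.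
    by apply: le_trans h2 _; exact: ler_norm.
  rewrite -(ler_pM2l t0); rewrite expr2 in h3; lra.
split=> // j.
have cS : 0 < cmod S by rewrite cmod_gt0.
pose K' := K / cmod S.
have K'0 : 0 <= K' by rewrite divr_ge0// ltW.
have [P EP] : exists P, P = l j / S by eexists.
have hP t : `|t| <= e1 -> exists rho, [/\ 0 < rho, `|rho - 1| <= 2 * `|t|, 0 <= t -> rho <= 1,
    converges_below (wmass a (tilt j t)) rho
  & cmod (ofreal (rho - 1) + ofreal (rho * (expR t - 1)) * P) <= K' * t ^+ 2].
  move=> te; have [rho [rho0 r1 r3 hin h]] := hK j t te; exists rho; split=> //.
  have -> : ofreal (rho - 1) + ofreal (rho * (expR t - 1)) * P =
     (ofreal (rho - 1) * S + ofreal (rho * (expR t - 1)) * l j) / S by rewrite EP; field.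
  by rewrite cmodM cmodV /K' mulrAC ler_pM2r ?invr_gt0.
have ReP t rho : complex.Re (ofreal (rho - 1) + ofreal (rho * (expR t - 1)) * P) =
    rho - 1 + rho * (expR t - 1) * complex.Re P.
  by case: (P) => u v /=; rewrite mul0r subr0.
have ImP t rho : complex.Im (ofreal (rho - 1) + ofreal (rho * (expR t - 1)) * P) =
    rho * (expR t - 1) * complex.Im P.
  by case: (P) => u v /=; rewrite mul0r addr0 add0r.
have im0 : complex.Im P = 0.
  apply/eqP; rewrite -normr_eq0 eq_le normr_ge0 andbT.
  apply: (@le0_of_small _ (2 * K') e2) => //; first by rewrite mulr_ge0.
  move=> t te; have /andP[t0 te2] := te.
  have [|rho [rho0 r1 _ _ h]] := hP t; first by rewrite gtr0_norm//; lra.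
  have := le_trans (Im_le_cmod _) h; rewrite ImP normrM => {}h.
  have h2 := half j t rho te r1.
  have h3 : t / 2 * `|complex.Im P| <= K' * t ^+ 2.
    apply: le_trans h; apply: ler_wpM2r => //.
    by apply: le_trans h2 _; exact: ler_norm.
  rewrite -(ler_pM2l t0); rewrite expr2 in h3; lra.
set p := complex.Re P.
pose K2 := K' + 6 * `|p|.
have K20 : 0 <= K2 by rewrite addr_ge0// mulr_ge0.
have hp t : `|t| <= e1 -> exists rho, [/\ 0 <= t -> rho <= 1,
    converges_below (wmass a (tilt j t)) rho & `|rho - (1 - t * p)| <= K2 * t ^+ 2].
  move=> te; have [rho [rho0 r1 r3 hin h]] := hP t te; exists rho; split=> //.
  have := le_trans (Re_le_cmod _) h; rewrite ReP -/p => {}h.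
  have ha := aux j t rho (le_trans te e1h) r1.
  have -> : rho - (1 - t * p) = (rho - 1 + rho * (expR t - 1) * p)
      - (rho * (expR t - 1) - t) * p by ring.
  apply: le_trans (ler_normB _ _) _; rewrite /K2 [leRHS]mulrDl; apply: lerD => //.
  by rewrite normrM [leRHS]mulrAC; apply: ler_wpM2r.
exists p; split.
- rewrite -oppr_le0; apply: (@le0_of_small _ K2 e1) => // t /andP[t0 te].
  have [|rho [r3 _ h]] := hp t; first by rewrite gtr0_norm.
  have := r3 (ltW t0); move: h; rewrite ler_norml => /andP[h _] rho1.
  rewrite -(ler_pM2l t0); move: h rho1; rewrite expr2; lra.
- have -> : ofreal p = P by rewrite /p; case: (P) im0 => u v /= ->.
  by rewrite EP divfK.
- by exists K2, e1; split=> // t /hp[rho [_ h1 h2]]; exists rho.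
Qed.

End Gradient.

(** Bounded terms at a radius r between q and rho make the numerator O((q / r)^k), while the
    denominator is at least m for large k. *)
Lemma chernoff_cvg j t q rho : converges_below (wmass a (tilt j t)) rho -> 0 < q < rho ->
  (fun k => wmass a (tilt j t) k * q ^+ k / (shell_mass a k * X ^+ k)) @ \oo --> (0 : R).
Proof.
move=> hin /andP[q0 qrho]; pose r := (q + rho) / 2.
have r0 : 0 < r by rewrite /r; lra.
have qr : q < r by rewrite /r; lra.
have [B hB] : exists B, pbnd (fun n => ofreal (wmass a (tilt j t) n)) r B.
  by apply: hin; rewrite r0 /r; lra.
have w0 k : 0 <= wmass a (tilt j t) k by apply: wmass_ge0 => // i; exact: tilt_gt0.
apply: (@squeeze_cvgr _ _ _ _ (fun=> 0) (fun k => B / m * (q / r) ^+ k)).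
- exists N => // k Nk /=; have mk := cm Nk; have mk0 := lt_le_trans m0 mk.
  have qk : 0 <= q ^+ k by rewrite exprn_ge0// ltW.
  rewrite (divr_ge0 (mulr_ge0 (w0 k) qk) (ltW mk0)) /= ler_pdivrMr//.
  have -> : B / m * (q / r) ^+ k * (shell_mass a k * X ^+ k) =
      (B / r ^+ k) * q ^+ k * ((shell_mass a k * X ^+ k) / m).
    by rewrite exprMn exprVn; ring.
  have hk : wmass a (tilt j t) k <= B / r ^+ k.
    by rewrite ler_pdivlMr ?exprn_gt0//; have := hB k; rewrite cmod_ofreal ger0_norm.
  apply: (@le_trans _ _ (B / r ^+ k * q ^+ k)); first exact: ler_wpM2r.
  rewrite ler_peMr//; first by apply: mulr_ge0 => //; exact: le_trans hk.
  by rewrite ler_pdivlMr// mul1r.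
- exact: (cvg_cst (0 : R)).
- rewrite -[X in _ --> X](mulr0 (B / m)); apply: cvgM; first exact: cvg_cst.
  apply: cvg_expr; rewrite (gtr0_norm (divr_gt0 q0 r0)).
  by rewrite ltr_pdivrMr// mul1r.
Qed.

(* Chernoff's bound with q = exp (- t p - |t| eps), which is less than rho for small t. *)
Lemma exponential_tail j (b : bool) (p eps K e1 : R) : 0 < eps -> 0 <= K -> 0 < e1 ->
  (forall t, `|t| <= e1 -> exists rho,
    converges_below (wmass a (tilt j t)) rho /\ `|rho - (1 - t * p)| <= K * t ^+ 2) ->
  exists tq : R * R, [/\ 0 < tq.2,
    (fun k => wmass a (tilt j tq.1) k * tq.2 ^+ k / (shell_mass a k * X ^+ k)) @ \oo --> (0 : R)
  & forall k s, (0 < k)%N -> eps < (-1) ^+ b * ((s j)%:R / k%:R - p) ->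
      1 <= expR tq.1 ^+ s j * tq.2 ^+ k].
Proof.
move=> eps0 K0 e10 h; pose P := `|p| + eps.
have P0 : 0 < P by rewrite /P ltr_wpDl.
have D0 : 0 < K + 2 * P ^+ 2 + 1 by rewrite ltr_wpDl// addr_ge0// mulr_ge0// exprn_ge0// ltW.
(* 1 / (2 P) keeps the exponent y within the range of [expR_taylor1]. The last bound makes the
   quadratic errors K dl^2 of rho and 2 (dl P)^2 of exp y together less than the margin dl eps; the
   summand 1 makes this strict. *)
pose dl := Num.min e1 (Num.min (1 / (2 * P)) (eps / (K + 2 * P ^+ 2 + 1))).
have dl0 : 0 < dl by rewrite !lt_min e10 !divr_gt0 ?mulr_gt0.
have [d1 d2 d3] : [/\ dl <= e1, dl <= 1 / (2 * P) & dl <= eps / (K + 2 * P ^+ 2 + 1)].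
  by split; rewrite !ge_min lexx ?orbT.
(* t takes the sign of the deviation to be excluded, so one argument covers both tails. *)
have [t Et] : exists t, t = (-1) ^+ b * dl by eexists.
pose y := - (t * p) - dl * eps.
have tn : `|t| = dl by rewrite Et normrM normr_sign mul1r gtr0_norm.
have [rho [hin hrho]] := h t (ltac:(by rewrite tn)).
have t2 : t ^+ 2 = dl ^+ 2 by rewrite -tn real_normK ?num_real.
have yP : `|y| <= dl * P.
  apply: le_trans (ler_normB _ _) _; rewrite normrN !normrM tn (gtr0_norm dl0) (gtr0_norm eps0).
  by rewrite -mulrDr.
have y2 : `|y| <= 1 / 2.
  apply: le_trans yP _; move: d2; rewrite ler_pdivlMr ?mulr_gt0//; lra.
have qrho : expR y < rho.
  have := expR_taylor1 y2; rewrite ler_norml => /andP[_ hy].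
  move: hrho; rewrite ler_norml t2 => /andP[hr _].
  have yy : y ^+ 2 <= (dl * P) ^+ 2.
    by rewrite -[y ^+ 2]real_normK ?num_real// lerXn2r ?nnegrE// mulr_ge0// ltW.
  have key : dl * (K * dl + 2 * dl * P ^+ 2 + dl) <= dl * eps.
    apply: ler_wpM2l; first exact: ltW.
    by move: d3; rewrite ler_pdivlMr//; lra.
  have dl2 : 0 < dl ^+ 2 by rewrite exprn_gt0.
  move: hr hy yy key dl2; rewrite /y exprMn !expr2; lra.
exists (t, expR y); split=> /=; first exact: expR_gt0.
  by apply: chernoff_cvg hin _; rewrite expR_gt0.
move=> k s k0 hs.
have kR : (0 : R) < k%:R by rewrite ltr0n.
rewrite -!expRM_natl -expRD -[leLHS]expR0 ler_expR.
have -> : (s j)%:R * t + k%:R * y = k%:R * dl * ((-1) ^+ b * ((s j)%:R / k%:R - p) - eps).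
  rewrite /y Et; field; exact: lt0r_neq0.
by apply: mulr_ge0; [rewrite mulr_ge0// ltW|rewrite subr_ge0 ltW].
Qed.

(** A union bound over the coordinates and the two signs of the deviation, each handled by its own
    exponential tail. *)
Lemma weak_law_of_radius (p : 'rV[R]_d) :
  (forall j, exists K e1, [/\ 0 <= K, 0 < e1 & forall t, `|t| <= e1 -> exists rho,
    converges_below (wmass a (tilt j t)) rho /\ `|rho - (1 - t * p 0 j)| <= K * t ^+ 2]) ->
  weak_law a p.
Proof.
(* If all d coordinates deviate by at most e, the 1-norm is at most eps; d + 1 avoids division by
   zero for d = 0. *)
move=> hp eps eps0; pose e := eps / d.+1%:R.
have e0 : 0 < e by rewrite divr_gt0.
have /choice[tq htq] : forall jb : 'I_d * bool, exists tq : R * R, [/\ 0 < tq.2,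
    (fun k => wmass a (tilt jb.1 tq.1) k * tq.2 ^+ k / (shell_mass a k * X ^+ k)) @ \oo --> (0 : R)
  & forall k s, (0 < k)%N -> e < (-1) ^+ jb.2 * ((s jb.1)%:R / k%:R - p 0 jb.1) ->
      1 <= expR tq.1 ^+ s jb.1 * tq.2 ^+ k].
  move=> [j b]; have [K [e1 [K0 e10 h]]] := hp j; exact: exponential_tail e0 K0 e10 h.
pose g (jb : 'I_d * bool) k := wmass a (tilt jb.1 (tq jb).1) k * (tq jb).2 ^+ k / (shell_mass a k * X ^+ k).
have gcvg (r : seq ('I_d * bool)) : (fun k => \sum_(jb <- r) g jb k) @ \oo --> (0 : R).
  elim: r => [|jb r IH].
    by under eq_fun do rewrite big_nil; exact: cvg_cst.
  under eq_fun do rewrite big_cons.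
  have [_ hd _] := htq jb; have := cvgD hd IH; rewrite addr0; exact.
apply: (@squeeze_cvgr _ _ _ _ (fun=> 0) (fun k => \sum_(jb : 'I_d * bool) g jb k)).
- exists (maxn N 1) => // k /=; rewrite geq_max => /andP[Nk k0].
  have mk := lt_le_trans m0 (cm Nk).
  have Xk : 0 < X ^+ k by rewrite exprn_gt0.
  have c0 : 0 < shell_mass a k by rewrite -(pmulr_lgt0 _ Xk).
  have -> : mu a k [set s | norm1 (scaled R k s - p) > eps] =
     \sum_(s <- shl d k) (if s \in [set s | norm1 (scaled R k s - p) > eps] then a s / shell_mass a k else 0).
    by rewrite /mu fsbig_mkcondr shell_sumE.
  apply/andP; split.
    by apply: sumr_ge0 => s _; case: ifP => // _; rewrite divr_ge0// ltW.
  (* Rewritten as a sum over s, the bound dominates the indicator termwise: a deviating s has some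
     (j, b) whose factor is at least 1. *)
  have -> : \sum_(jb : 'I_d * bool) g jb k = \sum_(s <- shl d k)
      \sum_(jb : 'I_d * bool) a s / shell_mass a k * (expR (tq jb).1 ^+ s jb.1 * (tq jb).2 ^+ k).
    rewrite exchange_big /=; apply: eq_bigr => jb _; rewrite /g wmass_tilt.
    set Sk := \sum_(s <- _) _.
    have -> : X ^+ k * Sk * (tq jb).2 ^+ k / (shell_mass a k * X ^+ k) =
        Sk * ((tq jb).2 ^+ k / shell_mass a k) by field; rewrite !lt0r_neq0.
    by rewrite mulr_suml; apply: eq_bigr => s _; ring.
  apply: ler_sum => s _.
  have F0 (jb : 'I_d * bool) : 0 <= a s / shell_mass a k * (expR (tq jb).1 ^+ s jb.1 * (tq jb).2 ^+ k).
    have [q0 _ _] := htq jb; apply: mulr_ge0; first by rewrite divr_ge0// ltW.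
    by rewrite mulr_ge0// exprn_ge0// ltW// expR_gt0.
  case: ifP => [/set_mem /= hs|_]; last exact: sumr_ge0.
  have [j hj] : exists j, e < `|(s j)%:R / k%:R - p 0 j|.
    case: (pickP (fun j => e < `|(s j)%:R / k%:R - p 0 j|)) => [j hj|hn]; first by exists j.
    exfalso; move: hs; apply/negP; rewrite -leNgt.
    apply: (@le_trans _ _ (\sum_(j < d) e)).
      by apply: ler_sum => j _; rewrite !mxE leNgt hn.
    rewrite sumr_const card_ord -mulr_natr /e mulrAC ler_pdivrMr// ler_pM2l// ler_nat//.
  have [b hb] : exists b : bool, e < (-1) ^+ b * ((s j)%:R / k%:R - p 0 j).
    move: hj; case: (leP 0 ((s j)%:R / k%:R - p 0 j)) => [h0|h0].
      by rewrite ger0_norm// => hj; exists false; rewrite expr0 mul1r.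
    by rewrite ltr0_norm// => hj; exists true; rewrite expr1 mulN1r.
  have [_ _ /(_ k s k0 hb) h1] := htq (j, b).
  rewrite (bigD1 (j, b))//=; apply: ler_wpDr; first exact: sumr_ge0.
  by rewrite ler_peMr// divr_ge0// ltW.
- exact: (cvg_cst (0 : R)).
- exact: gcvg.
Qed.

End Tilting.

(** * The diagonal ray and the normalization of the direction *)

Theorem mainTheorem5 (R : realType) (d : nat) (a : multiindex d -> R)
    (a_ge0 : forall s, 0 <= a s) :
  let F := mps_sum (fun s => ofreal (a s)) in
  let D := conv_domain (fun s => ofreal (a s)) in
  strictly_convex (log_domain D) ->
  forall (x0 : cplx R),
  unique_min_singularity_simple_pole
    [set t : cplx R | D (const_mx t)] (fun t : cplx R => F (const_mx t)) x0 ->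
  let x : 'rV[cplx R]_d := const_mx x0 in
  forall (U : set 'rV[cplx R]_d) (G H : 'rV[cplx R]_d -> cplx R),
  open U -> polydisk x `<=` U ->
  analytic_on U G -> analytic_on U H ->
  (forall z, U z -> D z -> H z != 0 -> F z = G z / H z) ->
  relatively_prime_on U G H -> square_free_on U H ->
  dir_vec H x != 0 ->
  (exists r, nonneg_representative (dir_vec H x) r) /\
  (forall r, nonneg_representative (dir_vec H x) r ->
     weak_law a ((norm1 r)^-1 *: r)).
Proof.
move=> F D _ x0 [g [near0 hg [h [hh hx0 hpole]]]] x U G H oU pU aG aH FGH _ _ dH.
have x00 : x0 != 0.
  apply/eqP => x0E; move/eqP: dH; apply; apply/rowP => j.
  by rewrite !mxE x0E mul0r.
(* The diagonal is the ray with all weights 1, so the lemmas on rays apply to f. *)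
have constE (t : cplx R) : const_mx t = t *: rrow (fun _ : 'I_d => 1 : R).
  by apply/rowP => j; rewrite !mxE rmorph1 mulr1.
have wmass1 : (fun k => ofreal (wmass a (fun=> 1) k)) = (fun k => ofreal (shell_mass a k)).
  apply/funext => k; congr ofreal; rewrite shell_massE; apply: eq_bigr => s _.
  by rewrite big1 ?mulr1// => j _; rewrite expr1n.
move/near_cplxP: near0 => [e0 e00 he0].
have r00 : 0 < e0 / 2 by rewrite divr_gt0.
have ce0 : cmod (ofreal (e0 / 2)) < e0 by rewrite cmod_ofreal gtr0_norm//; lra.
have [M0 cM0] : exists B, pbnd (fun n => ofreal (shell_mass a n)) (e0 / 2) B.
  have [|+ _] := he0 (ofreal (e0 / 2)); first by rewrite subr0.
  rewrite /= constE => /interior_subset /(mps_cvg_wmass_pbnd a_ge0 (fun=> ltr01) (ltW r00)).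
  by rewrite wmass1.
have gc z : cmod z < e0 / 2 -> g z = psum (fun n => ofreal (shell_mass a n)) z.
  move=> ze; have [|+ <-] := he0 z; first by rewrite subr0; lra.
  rewrite /= constE => /interior_subset Dz; rewrite /F (mps_sum_ray Dz).
  by rewrite wmass1.
have c0 n : 0 <= shell_mass a n by rewrite shell_massE sumr_ge0.
have hg' z : cmod z <= cmod x0 -> z != x0 -> has_expansion g z.
  by move=> zx zx0; apply/analytic1_expansion/hg => //; rewrite ler_norm_cmod.
have [X [m [M [N [x0E X0 m0 cM cm]]]]] :=
  pole_asymptotics c0 r00 cM0 gc hg' (analytic1_expansion hh) hx0 hpole x00.
have Ux : U (const_mx (ofreal X)) by apply: pU => j; rewrite !mxE x0E.
have [l [L [e [L0 ee0 Hl]]]] := analytic_first_order (aH _ Ux).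
have dirE j : dir_vec H x 0 j = ofreal X * l j.
  by rewrite !mxE /x x0E (derive_first_order L0 ee0 Hl).
have lN0 : exists j, l j != 0.
  move: dH => /rV0Pn[j]; rewrite dirE mulf_eq0 negb_or => /andP[_ lj].
  by exists j.
have [S0 hp] := gradient_direction a_ge0 X0 m0 cM cm oU Ux aG aH FGH L0 ee0 Hl lN0.
have /choice[p p_] := hp.
set S := \sum_j l j in S0 p_ *.
have oX0 : ofreal X != 0 by rewrite -x0E.
have sump : \sum_j ofreal (p j) = 1.
  apply: (mulIf S0); rewrite mul1r mulr_suml; apply: eq_bigr => j _.
  by have [_ <-] := p_ j.
have dirp j : dir_vec H x 0 j = ofreal X * S * ofreal (p j).
  by rewrite dirE; have [_ -> _] := p_ j; rewrite mulrAC mulrA.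
split.
  exists (\row_j p j); split; first by move=> j; rewrite mxE; have [] := p_ j.
  exists (ofreal X * S)^-1; first by rewrite invr_eq0 mulf_neq0.
  by move=> j; rewrite dirp mxE mulKf ?mulf_neq0.
(* A representative is kappa times p with kappa complex. As r is nonnegative and p sums to 1, kappa
   is the 1-norm of r, and normalizing leaves p. *)
move=> r [r0 [c cN0 rE]]; set kappa := c * (ofreal X * S).
have kappa0 : kappa != 0 by rewrite !mulf_neq0.
have rp j : ofreal (r 0 j) = kappa * ofreal (p j) by rewrite rE dirp mulrA.
have normE : ofreal (norm1 r) = kappa.
  rewrite rmorph_sum -[RHS]mulr1 -sump mulr_sumr; apply: eq_bigr => j _.
  by rewrite /= ger0_norm// rp.
suff -> : (norm1 r)^-1 *: r = \row_j p j.
  apply: (weak_law_of_radius a_ge0 X0 m0 cm) => j.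
  have [_ _ [K [e1 [K0 e10 h1]]]] := p_ j; exists K, e1; split=> // t /h1.
  by rewrite mxE.
have norm0 : ofreal (norm1 r) != 0 by rewrite normE.
apply/rowP => j; apply: ofrealI; rewrite !mxE rmorphM /= fmorphV rp -normE.
by rewrite mulKf.
Qed.
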